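(* Let $n$ be a cube-free positive integer coprime to $3$ having exactly two distinct prime factors $\ell_1$ and $\ell_2$. Then $\operatorname{rk} E_{-432n^2}(\mathbb{Q})=0$, i.e. $n$ is not a sum of two rational cubes, in each of the following cases: (1) $n=\ell_1\ell_2$ or $n=\ell_1^2\ell_2^2$, with $\ell_1\equiv 2 \pmod 9$ and $\ell_2\equiv 5\pmod 9$; (2) $n=\ell_1^2\ell_2$ with $\ell_1\equiv\ell_2\equiv 2\pmod 9$ or $\ell_1\equiv\ell_2\equiv 5\pmod 9$; (3) $n=\ell_1\ell_2$ or $n=\ell_1^2\ell_2$, with $n\equiv 2,5\pmod 9$, where $\ell_1\equiv 1\pmod 3$, $\ell_2\equiv 2\pmod 3$ and $\ell_2$ is not a cube in $\mathbb{F}_{\ell_1}$; (4) $n=\ell_1^2\ell_2^2$ or $n=\ell_1\ell_2^2$, with $n\equiv 4,7\pmod 9$, where $\ell_1\equiv 1\pmod 3$, $\ell_2\equiv 2\pmod 3$ and $\ell_2$ is not a cube in $\mathbb{F}_{\ell_1}$.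
   Context: For an integer $m\neq 0$, $E_m$ denotes the elliptic curve $y^2=x^3+m$ over $\mathbb{Q}$, and $\operatorname{rk} E_m(\mathbb{Q})$ its Mordell–Weil rank. *)

(* Defs.v *)
From HB Require Import structures.
From mathcomp Require Import all_boot all_order all_algebra.
Set Implicit Arguments. Unset Strict Implicit. Unset Printing Implicit Defensive.
Import Order.TTheory GRing.Theory Num.Theory.
Local Open Scope ring_scope.

(* A point of the projective plane model of E_m : y^2 = x^3 + m over Q:
   None is the point at infinity O, Some (x, y) an affine point. *)
Definition ptQ := option (rat * rat).

Definition on_Em (m : rat) (P : ptQ) : Prop :=
  match P with
  | None => True
  | Some (x, y) => y ^+ 2 = x ^+ 3 + m
  end.

(* The chord-tangent group law on E_m (Weierstrass form with a = 0). *)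
Definition addE (P Q : ptQ) : ptQ :=
  match P, Q with
  | None, _ => Q
  | _, None => P
  | Some (x1, y1), Some (x2, y2) =>
      if x1 == x2 then
        if y1 == - y2 then None
        else let l := (3 * x1 ^+ 2) / (2 * y1) in
             let x3 := l ^+ 2 - x1 - x2 in
             Some (x3, l * (x1 - x3) - y1)
      else let l := (y2 - y1) / (x2 - x1) in
           let x3 := l ^+ 2 - x1 - x2 in
           Some (x3, l * (x1 - x3) - y1)
  end.

Definition mulE (k : nat) (P : ptQ) : ptQ := iter k (addE P) None.

(* rk E_m(Q) = 0: E_m(Q) (x) Q = 0, i.e. every rational point is torsion. *)
Definition rank_zero (m : rat) : Prop :=
  forall P : ptQ, on_Em m P -> exists k : nat, (0 < k)%N /\ mulE k P = None.

Definition m_of_n (n : nat) : rat := - ((432 * n ^ 2)%N)%:R.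

Definition is_cube_mod (p a : nat) : Prop := exists x : nat, x ^ 3 = a %[mod p].

(* Main.v *)
From HB Require Import structures.
Require Import Defs.
From mathcomp Require Import all_boot all_order all_algebra all_field.
From mathcomp Require Import ring zify.
Set Implicit Arguments. Unset Strict Implicit. Unset Printing Implicit Defensive.
Import Order.TTheory GRing.Theory Num.Theory.

(* A rational point of E_{-432 n^2} gives coprime x, y with x^3 + y^3 = n z^3 and
   z <> 0. Factor the left side as (x + y)(x^2 - xy + y^2), the second factor
   being, up to 3, the norm of a primary Eisenstein integer (one congruent to a
   rational integer modulo 3). If that norm is a cube v^3, the integer is a cube,
   and x + y becomes a product of three linear forms with zero sum; these are
   cubes up to the prime powers of n, giving either a smaller solution or
   l1^i X^3 + l2^j Y^3 + Z^3 = 0, which fails modulo 9 or modulo l1. (For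
   n = +-1 mod 9 and z prime to 3, x + y is instead a cubic form with splitting
   field Q(zeta_9)^+, without primitive zeros modulo l1 = 2, 5 mod 9.) If the
   norm is l1^i v^3, then some pi | l1 divides the integer, and x + y = l2^j u^3
   would make l2 a cube modulo pi, because a primary pi has its conjugate a cube
   modulo pi: pi may be taken to be the Jacobi sum J(chi, chi), and
   conj J = - (-1)^m 'C(2 m, m) = 1 / (m!)^3 modulo pi when l1 = 3 m + 1. *)

Section NoCubeSum.
Local Open Scope ring_scope.

(** * The ring of Eisenstein integers *)

(* Eis a b stands for a + b * omega with omega ^ 2 + omega + 1 = 0. *)
Record eis := Eis { eis1 : int; eis2 : int }.

Fact eis_pairK : cancel (fun x => (eis1 x, eis2 x)) (fun p => Eis p.1 p.2).
Proof. by case. Qed.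
HB.instance Definition _ := Choice.copy eis (can_type eis_pairK).

Definition eis_add (x y : eis) : eis := Eis (eis1 x + eis1 y) (eis2 x + eis2 y).
Definition eis_opp (x : eis) : eis := Eis (- eis1 x) (- eis2 x).
Definition eis_mul (x y : eis) : eis :=
  Eis (eis1 x * eis1 y - eis2 x * eis2 y)
      (eis1 x * eis2 y + eis2 x * eis1 y - eis2 x * eis2 y).

Fact eis_addA : associative eis_add.
Proof. by move=> [a b] [c d] [e f]; congr Eis => /=; ring. Qed.
Fact eis_addC : commutative eis_add.
Proof. by move=> [a b] [c d]; congr Eis => /=; ring. Qed.
Fact eis_add0 : left_id (Eis 0 0) eis_add.
Proof. by move=> [a b]; congr Eis => /=; ring. Qed.
Fact eis_addN : left_inverse (Eis 0 0) eis_opp eis_add.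
Proof. by move=> [a b]; congr Eis => /=; ring. Qed.
HB.instance Definition _ :=
  GRing.isZmodule.Build eis eis_addA eis_addC eis_add0 eis_addN.

Fact eis_mulA : associative eis_mul.
Proof. by move=> [a b] [c d] [e f]; congr Eis => /=; ring. Qed.
Fact eis_mulC : commutative eis_mul.
Proof. by move=> [a b] [c d]; congr Eis => /=; ring. Qed.
Fact eis_mul1 : left_id (Eis 1 0) eis_mul.
Proof. by move=> [a b]; congr Eis => /=; ring. Qed.
Fact eis_mulD : left_distributive eis_mul eis_add.
Proof. by move=> [a b] [c d] [e f]; congr Eis => /=; ring. Qed.
Fact eis_1neq0 : Eis 1 0 != (0 : eis).
Proof. by []. Qed.
HB.instance Definition _ := GRing.Zmodule_isComNzRing.Build eis
  eis_mulA eis_mulC eis_mul1 eis_mulD eis_1neq0.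

Lemma eis0E : (0 : eis) = Eis 0 0. Proof. by []. Qed.
Lemma eis1E : (1 : eis) = Eis 1 0. Proof. by []. Qed.
Lemma eisDE (a b c d : int) : Eis a b + Eis c d = Eis (a + c) (b + d).
Proof. by []. Qed.
Lemma eisNE (a b : int) : - Eis a b = Eis (- a) (- b).
Proof. by []. Qed.
Lemma eisME (a b c d : int) :
  Eis a b * Eis c d = Eis (a * c - b * d) (a * d + b * c - b * d).
Proof. by []. Qed.
Definition eisE := (eisDE, eisNE, eisME, eis0E, eis1E).

Definition omega : eis := Eis 0 1.
Definition econj (x : eis) : eis := Eis (eis1 x - eis2 x) (- eis2 x).
Definition enorm (x : eis) : int := eis1 x ^+ 2 - eis1 x * eis2 x + eis2 x ^+ 2.

Lemma eis_int_eq (a b : int) : Eis a b = a%:~R + b%:~R * omega.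
Proof.
have E (c : int) : c%:~R = Eis c 0.
  have En (k : nat) : (k%:R : eis) = Eis k%:Z 0.
    by elim: k => // k IHk; rewrite -addn1 natrD IHk eisE; congr Eis; lia.
  by case: c => k; rewrite ?NegzE ?mulrNz -pmulrn En ?eisNE.
by rewrite !E !eisE; congr Eis => /=; ring.
Qed.

Fact econj_zmod : zmod_morphism econj.
Proof. by move=> [a b] [c d]; rewrite !eisE; congr Eis => /=; ring. Qed.
Fact econj_monoid : monoid_morphism econj.
Proof. by split=> // -[a b] [c d]; rewrite !eisE; congr Eis => /=; ring. Qed.
HB.instance Definition _ := GRing.isZmodMorphism.Build eis eis econj econj_zmod.
HB.instance Definition _ := GRing.isMonoidMorphism.Build eis eis econj econj_monoid.

Lemma eis_int (c : int) : (c%:~R : eis) = Eis c 0.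
Proof. by have := eis_int_eq c 0; rewrite mul0r addr0 => <-. Qed.

Lemma mul_econj x : x * econj x = Eis (enorm x) 0.
Proof. by case: x => a b; rewrite /econj /enorm !eisE; congr Eis => /=; ring. Qed.

Lemma enormM x y : enorm (x * y) = enorm x * enorm y.
Proof. by case: x y => [a b] [c d]; rewrite eisE /enorm /=; ring. Qed.

Lemma enorm_ge0 x : 0 <= enorm x.
Proof. by case: x => a b; rewrite /enorm /=; nia. Qed.

Lemma enorm_eq0 x : enorm x = 0 -> x = 0.
Proof. by case: x => a b; rewrite /enorm /= => H; congr Eis; nia. Qed.

Lemma eis_mulI (x y : eis) : x * y = 0 -> x = 0 \/ y = 0.
Proof.
move/(congr1 enorm); rewrite enormM => /eqP.
rewrite (_ : enorm 0 = 0) // mulf_eq0 => /orP[] /eqP /enorm_eq0; by [left | right].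
Qed.

Lemma round_div (a n : int) : 0 < n -> exists q, - n <= 2 * (a - q * n) <= n.
Proof.
(* The floor of a / n + 1 / 2. *)
move=> n0; exists ((2 * a + n) %/ (2 * n))%Z.
have := divz_eq (2 * a + n) (2 * n); have := modz_ge0 (2 * a + n) (d := 2 * n) ltac:(lia).
have := ltz_pmod (2 * a + n) (d := 2 * n) ltac:(lia).
by set q := (_ %/ _)%Z; set r := (_ %% _)%Z; nia.
Qed.

(** Both coordinates of x / y = x conj(y) / N(y) are rounded to nearest integers; errors of at most
    1/2 leave a norm of at most 3/4. *)
Lemma eis_euclid x y : y != 0 -> exists q, enorm (x - q * y) < enorm y.
Proof.
move=> y0; have Ny : 0 < enorm y.
  by rewrite lt_def enorm_ge0 andbT; apply: contra_neq y0 => /enorm_eq0.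
case E: (x * econj y) => [c d].
have [q Hq] := round_div c Ny; have [r Hr] := round_div d Ny.
exists (Eis q r).
have {E} : (x - (Eis q r) * y) * econj y = Eis (c - q * enorm y) (d - r * enorm y).
  rewrite mulrBl E -mulrA mul_econj !eisE; congr Eis => /=; ring.
move/(congr1 enorm); rewrite enormM.
have -> : enorm (econj y) = enorm y by case: (y) => a b; rewrite /enorm /econj /=; ring.
move: Hq Hr; set N := enorm y in Ny *; set e := c - _; set f := d - _.
rewrite [enorm (Eis e f)]/enorm /=; move: (enorm (_ - _)) e f => M e f He Hf.
by nia.
Qed.

Lemma eis_bezout (x y : eis) :
  exists d s t x' y', [/\ d = s * x + t * y, x = x' * d & y = y' * d].
Proof.
have [k] := ubnP `|enorm y|%N; elim: k x y => // k IHk x y ltk.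
have [->|y0] := eqVneq y 0.
  by exists x, 1, 0, 1, 0; split; ring.
have [q Hq] := eis_euclid x y0.
have [|d [s [t [x' [y' [Hd Hx Hy]]]]]] := IHk y (x - q * y).
  have := enorm_ge0 (x - q * y); move: Hq ltk; move: (enorm _) (enorm _) => M N; lia.
exists d, t, (s - t * q), (y' + q * x'), x'; split => //.
  by rewrite Hd; ring.
by rewrite mulrDl -Hy -mulrA -Hx; ring.
Qed.

(* With (d) the ideal (x, z), the ideal (d^3) = x (x^2, xz, z^2, y) equals (x),
   the second factor being the unit ideal. *)
Lemma gcd_cube_assoc (R : comNzRingType) (x y z s t d a b x' z' : R) :
  x * y = z ^+ 3 -> s * x + t * y = 1 ->
  d = a * x + b * z -> x = x' * d -> z = z' * d ->
  exists u v, x = u * d ^+ 3 /\ d ^+ 3 = v * x.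
Proof.
move=> Exyz Bez Ed Ex Ez.
exists (s ^+ 2 * x' ^+ 3 + t * (s * x + 1) * z' ^+ 3).
exists (a ^+ 3 * x ^+ 2 + 3 * a ^+ 2 * b * x * z + 3 * a * b ^+ 2 * z ^+ 2 + b ^+ 3 * y).
split.
  transitivity (s ^+ 2 * x ^+ 3 + t * (s * x + 1) * (x * y)).
    have -> : t * (s * x + 1) = t * (s * x + (s * x + t * y)) by rewrite Bez.
    by transitivity (x * (s * x + t * y) ^+ 2); [rewrite Bez|]; ring.
  by rewrite Exyz [in x ^+ 3]Ex Ez; ring.
have -> : d ^+ 3 = a ^+ 3 * x ^+ 3 + 3 * a ^+ 2 * b * x ^+ 2 * z + 3 * a * b ^+ 2 * x * z ^+ 2
   + b ^+ 3 * z ^+ 3 by rewrite Ed; ring.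
by rewrite -Exyz; ring.
Qed.

(** By [gcd_cube_assoc], x and the cube of gcd(x, z) divide each other, so their quotient is a unit
    and has norm 1. *)
Lemma coprime_mul_cube (x y z s t : eis) :
  x * y = z ^+ 3 -> s * x + t * y = 1 ->
  exists d e, x = e * d ^+ 3 /\ enorm e = 1.
Proof.
move=> Exyz Bez; have [d [a [b [x' [z' [Ed Ex Ez]]]]]] := eis_bezout x z.
have [x0|x0] := eqVneq x 0.
  by exists 0, 1; split => //; rewrite x0; ring.
have [u [v [Eu Ev]]] := gcd_cube_assoc Exyz Bez Ed Ex Ez.
exists d, u; split => //.
have /eis_mulI[/eqP|E] : x * (1 - u * v) = 0; first by rewrite mulrBr mulr1 {1}Eu Ev; ring.
  by rewrite (negPf x0).
have : u * v = 1 by apply/esym/eqP; rewrite -subr_eq0 E.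
move/(congr1 enorm); rewrite enormM (_ : enorm 1 = 1) //.
have := enorm_ge0 u; have := enorm_ge0 v; move: (enorm u) (enorm v) => M N.
have [->|M0] := eqVneq M 0; have [->|N0] := eqVneq N 0; nia.
Qed.

Lemma cube_root1 (R : comNzRingType) (w : R) : w ^+ 2 + w + 1 = 0 -> w ^+ 3 = 1.
Proof.
move=> Ew; have E3 : w ^+ 3 = 1 + (w - 1) * (w ^+ 2 + w + 1) by ring.
by rewrite E3 Ew mulr0 addr0.
Qed.

(** Serves to show that w and w^2 differ in a field where 3 is nonzero. *)
Lemma cube_root1_sub (R : comNzRingType) (w : R) : w ^+ 2 + w + 1 = 0 ->
  (w - w ^+ 2) ^+ 2 = - 3.
Proof.
move=> Ew; have E3 : (w - w ^+ 2) ^+ 2 = (w ^+ 2 + w + 1) * (w ^+ 2 - 3 * w + 3) - 3 by ring.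
by rewrite E3 Ew mul0r sub0r.
Qed.

(** With alpha = a + b omega, the ideal (alpha, conj alpha) contains a + b = - (omega alpha +
    omega^2 conj alpha) and 3 b = (1 + 2 omega) (conj alpha - alpha), which are coprime integers. *)
Lemma coprimez_conj (a b : int) : coprimez a b -> ~~ (3 %| a)%Z -> (3 %| b)%Z ->
  exists s t, s * Eis a b + t * econj (Eis a b) = 1.
Proof.
move=> cab a3 b3.
have /coprimezP[[u v] /= E] : coprimez (a + b) (3 * b).
  rewrite coprimezMr; apply/andP; split.
    rewrite /coprimez gcdzC -/(coprimez _ _) coprimezE prime_coprime //.
    by rewrite -[(_ %| _)%N]/(3 %| a + b)%Z rpredDr.
  by rewrite /coprimez gcdzC gcdzDr gcdzC -/(coprimez _ _).
exists (- Eis 0 u - Eis v (2 * v)), (Eis u u + Eis v (2 * v)).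
rewrite /econj /= !eisE; congr Eis => /=; [rewrite -[RHS]E|]; ring.
Qed.

(** Four times the norm is (2 c - 3 k)^2 + 27 k^2. Hence a unit congruent to a rational integer
    modulo 3 is 1 or -1. *)
Lemma norm1_dvd3 (c k : int) : c ^+ 2 - c * (k * 3) + (k * 3) ^+ 2 = 1 -> k = 0.
Proof.
move=> E; have E4 : (2 * c - 3 * k) ^+ 2 + 27 * k ^+ 2 = 4.
  by rewrite -[RHS]mulr1 -[X in 4 * X]E; ring.
have k1 : k ^+ 2 < 1 ^+ 2.
  by have := sqr_ge0 (2 * c - 3 * k); move: (_ ^+ 2) E4 => q; rewrite expr1n; lia.
have : `|k| < 1 by rewrite -ltr_sqr ?nnegrE // real_normK ?num_real.
by lia.
Qed.

(** Being coprime to its conjugate, a + b omega is a unit times a cube. The second coordinate of a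
    cube is divisible by 3, so the unit is 1 or -1, itself a cube. *)
Lemma primary_norm_cube (a b v : int) :
  coprimez a b -> ~~ (3 %| a)%Z -> (3 %| b)%Z -> a ^+ 2 - a * b + b ^+ 2 = v ^+ 3 ->
  exists r s, a = r ^+ 3 + s ^+ 3 - 3 * r * s ^+ 2 /\ b = 3 * r * s * (r - s).
Proof.
move=> cab a3 b3 E; have [s [t Bez]] := coprimez_conj cab a3 b3.
have Ev : Eis a b * econj (Eis a b) = (Eis v 0) ^+ 3.
  rewrite mul_econj /enorm /= E !exprS expr0 !eisE; congr Eis => /=; ring.
have [[x y] [[c d] [Eab Nd]]] := coprime_mul_cube Ev Bez.
(* The coordinates of (x + y omega)^3. *)
set A := x ^+ 3 + y ^+ 3 - 3 * x * y ^+ 2; set B := 3 * x * y * (x - y).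
have {Ev Bez s t} [Ea Eb] : a = c * A - d * B /\ b = c * B + d * A - d * B.
  move: Eab; rewrite !exprS expr0 !eisE => -[-> ->]; split; rewrite /A /B; ring.
have B3 : (3 %| B)%Z by rewrite /B -!mulrA dvdz_mulr.
have A3 : ~~ (3 %| A)%Z.
  by apply: contra a3 => A3; rewrite Ea rpredB // dvdz_mull.
have d3 : (3 %| d)%Z.
  have : (3 %| d * A)%Z.
    have -> : d * A = b - c * B + d * B by rewrite Eb; ring.
    by rewrite rpredD ?rpredB // dvdz_mull.
  by rewrite Gauss_dvdzl // coprimezE prime_coprime // -dvdzE.
have {d3 Nd Eab} [d0 c1] : d = 0 /\ (c = 1 \/ c = -1).
  case/dvdzP: d3 => k dk; move: Nd; rewrite /enorm /= {}dk => Nd.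
  have k0 := norm1_dvd3 Nd.
  split; first by rewrite k0 mul0r.
  have /eqP : c ^+ 2 = 1 by rewrite -Nd k0; ring.
  by rewrite sqrf_eq1 => /orP[]/eqP; [left|right].
case: c1 => c1; rewrite c1 d0 in Ea Eb.
  by exists x, y; rewrite Ea Eb /A /B; split; ring.
by exists (- x), (- y); rewrite Ea Eb /A /B; split; ring.
Qed.

(** * Cube roots of unity in finite fields *)

Lemma finField_expr_neq1 (F : finFieldType) (k : nat) : (0 < k)%N -> (k.+1 < #|F|)%N ->
  exists2 g : F, g != 0 & g ^+ k != 1.
Proof.
move=> k0 kF.
have [g] : exists g : F, (g != 0) && (g ^+ k != 1).
  apply/existsP; apply: contraT; rewrite negb_exists => /forallP H.
  have pN0 : 'X^k - 1 != 0 :> {poly F} by rewrite -size_poly_eq0 size_XnsubC.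
  have := max_poly_roots pN0 (rs := [seq x <- enum F | x != 0]).
  rewrite size_XnsubC // filter_uniq ?enum_uniq //.
  rewrite (_ : size _ = #|F|.-1); last first.
    have E1 : count (predC (fun x : F => x != 0)) (enum F) = 1%N.
      rewrite (eq_count (a2 := pred1 0)); last by move=> x /=; rewrite negbK.
      by rewrite count_uniq_mem ?enum_uniq // mem_enum.
    have := count_predC (fun x : F => x != 0) (enum F).
    by rewrite E1 -cardT addn1 size_filter => <-.
  move=> /(_ _ isT) W; suff : (#|F|.-1 < k.+1)%N.
    by rewrite ltnNge -ltnS prednK ?kF // (leq_trans _ kF).
  apply: W; apply/allP => x; rewrite mem_filter => /andP[x0 _].
  have := H x; rewrite x0 /= negbK rootE !hornerE => /eqP->.
  by rewrite subrr.
by case/andP=> g0 gk; exists g.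
Qed.

(** Some nonzero g has g^m different from 1, while its cube g^(3 m) is 1. *)
Lemma finField_cube_root (F : finFieldType) (m : nat) : #|F| = (3 * m).+1 ->
  exists2 g : F, g != 0 & (g ^+ m) ^+ 2 + g ^+ m + 1 = 0.
Proof.
move=> cF.
have m0 : (0 < m)%N by have := finRing_gt1 F; rewrite cF; lia.
have [g g0 gm] := finField_expr_neq1 (F := F) m0 ltac:(rewrite cF; lia).
exists g => //.
have := expf_card g; rewrite cF exprS => /(canRL (mulKf g0)).
rewrite mulVf // mulnC exprM => E.
move: (g ^+ m) gm E => h h1 E; apply/eqP.
have /eqP : (h - 1) * (h ^+ 2 + h + 1) = 0.
  by rewrite -[RHS](subrr 1) -[X in _ = X - 1]E; ring.
by rewrite mulf_eq0 subr_eq0 (negPf h1).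
Qed.

(* The cubic form is - Tr (omega * beta ^ 3) with beta = r + s * omega. If it
   vanished in F_(l^2) at a unit beta, then beta ^ l = conj beta would force
   omega ^ (2 * (l + 1) / 3) = 1, hence 9 %| l + 1. *)
Lemma ninth_root_form (l : nat) (r s : int) : prime l ->
  (l %% 9 = 2 \/ l %% 9 = 5)%N ->
  (l %| r ^+ 3 + s ^+ 3 + 3 * r ^+ 2 * s - 6 * r * s ^+ 2)%Z ->
  (l %| r)%Z /\ (l %| s)%Z.
Proof.
move=> pl l9; have [F lF cF] := pPrimePowerField pl (isT : (0 < 2)%N).
rewrite !(dvdz_pcharf lF).
have [k lk] : exists k, l = (3 * k + 2)%N by exists (l %/ 3)%N; lia.
have [g g0 Ew] := finField_cube_root (F := F) (m := (l ^ 2).-1 %/ 3)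
  ltac:(rewrite cF; nia).
move: (g ^+ _) Ew => w {g g0} Ew.
have w3 := cube_root1 Ew.
have wl : w ^+ l = w ^+ 2 by rewrite lk exprD exprM w3 expr1n mul1r.
set a : F := r%:~R; set b : F := s%:~R => /eqP El.
have {El} E : a ^+ 3 + b ^+ 3 + 3 * a ^+ 2 * b - 6 * a * b ^+ 2 = 0.
  by rewrite -[RHS]El /a /b; ring.
pose x := a + b * w.
have xl : x ^+ l = a + b * w ^+ 2.
  rewrite -(pFrobenius_autE lF) pFrobenius_autD_comm; last exact: mulrC.
  by rewrite pFrobenius_autM_comm ?pFrobenius_aut_int ?pFrobenius_autE ?wl //; exact: mulrC.
have n3 : (3 : F) != 0.
  by rewrite -(dvdn_pcharf lF) dvdn_prime2 //; apply/eqP; lia.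
(* If x is not a unit, x and its conjugate [x ^+ l] both vanish, hence so do b and a. *)
have [x0|x0] := eqVneq x 0.
  have : b * (w - w ^+ 2) = x - x ^+ l by rewrite xl /x; ring.
  rewrite x0 expr0n lk addn2 subrr => /eqP; rewrite mulf_eq0 => /orP[/eqP b0|].
    by move: x0; rewrite /x b0 mul0r addr0 => ->; rewrite !eqxx.
  by rewrite -sqrf_eq0 cube_root1_sub // oppr_eq0 (negPf n3).
have Exl : w * x ^+ 3 + w ^+ 2 * (x ^+ l) ^+ 3 = 0.
  rewrite xl /x; transitivity (- (a ^+ 3 + b ^+ 3 + 3 * a ^+ 2 * b - 6 * a * b ^+ 2)
    + (w ^+ 2 + w + 1) * (a ^+ 3 + 3 * a ^+ 2 * b * (w ^+ 2 - w + 1)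
      + 3 * a * b ^+ 2 * ((w - 1) + (w ^+ 3 + 1) * (w - 1))
      + b ^+ 3 * (w ^+ 2 - w + 1) * (w ^+ 4 - w ^+ 2 + 1))); first by ring.
  by rewrite E Ew mul0r oppr0 addr0.
pose y := x ^+ l.-1.
have xy : x ^+ l = x * y by rewrite -exprS prednK ?prime_gt0.
have wy : w * y ^+ 3 = - 1.
  have w0 : w != 0 by apply: contra_eq_neq Ew => ->; rewrite expr0n !add0r oner_eq0.
  apply: (mulfI (mulf_neq0 w0 (expf_neq0 3 x0))); apply/eqP; rewrite -subr_eq0 -{}Exl xy.
  by apply/eqP; ring.
(* Here 3 (k + 1) = l + 1, and x^(l^2 - 1) = 1. *)
have yl : (y ^+ 3) ^+ k.+1 = 1.
  rewrite -!exprM; apply: (mulfI x0); rewrite mulr1 -exprS.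
  rewrite -[RHS](expf_card x) cF; congr (x ^+ _); rewrite lk; lia.
have : w ^+ (k.+1 * 2) = 1.
  have : (w * y ^+ 3) ^+ (k.+1 * 2) = 1 by rewrite wy mulnC exprM sqrrN expr1n expr1n.
  by rewrite exprMn [(y ^+ 3) ^+ _]exprM yl expr1n mulr1.
have w1 : w = 1 -> False.
  by move=> w1; move: Ew; rewrite w1 => E3; case/eqP: n3; rewrite -E3; ring.
(* For l = 2 or 5 modulo 9, 3 does not divide k + 1, so the exponent is prime to 3 and w would be
   1. *)
have [q [->|->]] : exists q, (k.+1 * 2 = 3 * (2 * q) + 2 \/ k.+1 * 2 = 3 * (2 * q + 1) + 1)%N.
  by exists (k %/ 3)%N; lia.
- rewrite exprD exprM w3 expr1n mul1r => w2; case: w1.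
  by rewrite -[RHS]w3 exprS w2 mulr1.
- by rewrite exprD exprM w3 expr1n mul1r.
Qed.

(** * Cubic Jacobi sums *)

(** When w^2 + w + 1 = 0 this is the ring morphism sending omega to w. Over ['F_p] it is reduction
    modulo a prime above p, and w^2 gives the conjugate prime. *)
Definition eis_eval (R : comNzRingType) (w : R) (x : eis) : R :=
  (eis1 x)%:~R + (eis2 x)%:~R * w.

Lemma eis_evalD (R : comNzRingType) (w : R) : {morph eis_eval w : x y / x + y}.
Proof. by move=> [a b] [c d]; rewrite /eis_eval /=; ring. Qed.

Lemma eis_eval_sum (R : comNzRingType) (w : R) (I : finType) (f : I -> eis) :
  eis_eval w (\sum_i f i) = \sum_i eis_eval w (f i).
Proof.
by apply: (big_morph _ (eis_evalD w)); rewrite /eis_eval mul0r addr0.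
Qed.

Lemma eis_evalM (R : comNzRingType) (w : R) : w ^+ 2 + w + 1 = 0 ->
  {morph eis_eval w : x y / x * y}.
Proof.
move=> Ew [a b] [c d]; rewrite /eis_eval /=; apply/eqP; rewrite -subr_eq0.
rewrite -(mulr0 (- (b * d)%:~R)) -Ew; apply/eqP; ring.
Qed.

Lemma eis_eval_conj (R : comNzRingType) (w : R) (x : eis) : w ^+ 2 + w + 1 = 0 ->
  eis_eval w (econj x) = eis_eval (w ^+ 2) x.
Proof.
case: x => a b Ew; rewrite /eis_eval /=; apply/eqP; rewrite -subr_eq0.
rewrite -(mulr0 (- b%:~R)) -Ew; apply/eqP; ring.
Qed.

Definition cubic_values : seq eis := [:: 0; 1; omega; omega ^+ 2].

(** Identities between character values are thereby checked by evaluation. *)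
Lemma cubic_valuesP (P : pred eis) :
  P 0 -> P 1 -> P omega -> P (omega ^+ 2) -> {in cubic_values, forall u, P u}.
Proof. by move=> ? ? ? ?; apply/allP; apply/and5P. Qed.

Lemma cubic_values_mul : {in cubic_values &, forall u v, u * v \in cubic_values}.
Proof.
move=> u v uV; apply: (cubic_valuesP (P := fun v => u * v \in cubic_values));
  by move: u uV; apply: cubic_valuesP.
Qed.

Lemma cubic_values_conj : {in cubic_values, forall u, econj u = u ^+ 2}.
Proof. by move=> u uV; apply/eqP; move: u uV; apply: cubic_valuesP. Qed.

Lemma cubic_values_norm : {in cubic_values, forall u, u != 0 -> econj u * u = 1}.
Proof.
move=> u uV u0; apply/eqP; move: u0; apply/implyP; move: u uV.
exact: (cubic_valuesP (P := fun u => (u != 0) ==> (econj u * u == 1))).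
Qed.

(** Makes distinct character values stay distinct modulo a prime not above 3. *)
Lemma cubic_values_sub : {in cubic_values &, forall u v, u != v -> enorm (u - v) \in [:: 1; 3]}.
Proof.
move=> u v uV vV; apply/implyP; move: v vV.
apply: (cubic_valuesP (P := fun v => (u != v) ==> (enorm (u - v) \in [:: 1; 3])));
  move: u uV; apply: cubic_valuesP.
all: by [].
Qed.

(** On 1, omega, omega^2 the second coordinate is 0, 1, -1: a discrete logarithm modulo 3. *)
Lemma cubic_values_mod3 : {in cubic_values &, forall u v, u != 0 -> v != 0 ->
  (3 %| eis2 (u * v) - eis2 u - eis2 v)%Z}.
Proof.
move=> u v uV vV u0 v0; move: u0; apply/implyP; move: v0; apply/implyP; move: v vV.
apply: (cubic_valuesP (P := fun v => (v != 0) ==> ((u != 0) ==>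
  (3 %| eis2 (u * v) - eis2 u - eis2 v)%Z)));
  move: u uV; apply: cubic_valuesP.
all: by [].
Qed.

(** The vanishing sum expresses that the character is nontrivial. *)
Record cubic_character (F : finFieldType) (chi : F -> eis) : Prop := CubicCharacter {
  cubic_char_val : forall x, chi x \in cubic_values;
  cubic_charM : {morph chi : x y / x * y};
  cubic_char_eq0 : forall x, (chi x == 0) = (x == 0);
  cubic_char_sum : \sum_x chi x = 0 }.

Section CubicCharacter.
Context (F : finFieldType) (chi : F -> eis) (chiP : cubic_character chi).

Lemma cubic_char0 : chi 0 = 0.
Proof. by apply/eqP; rewrite cubic_char_eq0. Qed.

Lemma cubic_char1 : chi 1 = 1.
Proof.
have n0 : chi 1 != 0 by rewrite (cubic_char_eq0 chiP) oner_eq0.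
rewrite -[LHS]mul1r -(cubic_values_norm (cubic_char_val chiP 1) n0) -mulrA.
by rewrite -(cubic_charM chiP) mulr1.
Qed.

Lemma cubic_charV x : chi x^-1 = econj (chi x).
Proof.
have [->|x0] := eqVneq x 0; first by rewrite invr0 cubic_char0 rmorph0.
have n0 : chi x != 0 by rewrite (cubic_char_eq0 chiP).
rewrite -[LHS]mul1r -(cubic_values_norm (cubic_char_val chiP x) n0) -mulrA.
by rewrite -(cubic_charM chiP) divff // cubic_char1 mulr1.
Qed.

Definition jacobi : eis := \sum_x chi x * chi (1 - x).

Lemma cubic_char_sumX2 : \sum_x chi x ^+ 2 = 0.
Proof.
rewrite (eq_bigr (fun x => econj (chi x))) => [|x _].
  by rewrite -rmorph_sum (cubic_char_sum chiP) rmorph0.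
by rewrite cubic_values_conj ?(cubic_char_val chiP).
Qed.

(* For t != 1 the Moebius map y -> (1 - t y) / (1 - y) misses only t on F \ {1};
   with 1 / 0 = 0 its continuation t + (1 - t) / (1 - y) is a bijection of F. *)
Lemma sum_cubic_char_moebius (t : F) :
  \sum_(y | y != 0) chi ((1 - t * y) / (1 - y)) = #|F|%:R *+ (t == 1) - 1 - chi t.
Proof.
(* Two corrections: y = 0 is left out on the left but gives chi 1 = 1 on the right; at y = 1
   division by zero gives chi 0 on the left but chi t on the right. *)
have E y : (if y != 0 then chi ((1 - t * y) / (1 - y)) else 0) =
    chi (t + (1 - t) / (1 - y)) - 1 *+ (y == 0) - chi t *+ (y == 1).
  have [->|y0] /= := eqVneq y 0.
    by rewrite [0 == 1]eq_sym oner_eq0 (subr0 1) divr1 [t + _]addrC subrK cubic_char1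
      mulr1n mulr0n subr0 subrr.
  have [->|y1] := eqVneq y 1.
    by rewrite (subrr 1) invr0 !mulr0 !addr0 cubic_char0 ?subr0 mulr1n subrr.
  rewrite subr0 mulr0n subr0; congr chi; have : 1 - y != 0 by rewrite subr_eq0 eq_sym.
  by move=> ?; field.
rewrite big_mkcond (eq_bigr _ (fun y _ => E y)) !sumrB.
have D (c : eis) (z : F) : \sum_y c *+ (y == z) = c.
  by rewrite (bigD1 z) //= eqxx big1 ?addr0 // => y /negPf->.
rewrite !D; congr (_ - _ - _).
have [->|t1] := eqVneq t 1.
  under eq_bigr do rewrite subrr mul0r addr0 cubic_char1.
  by rewrite sumr_const.
rewrite mulr0n -[RHS](cubic_char_sum chiP)
  [RHS](reindex_inj (h := fun y => t + (1 - t) / (1 - y))) //.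
move=> y z /addrI /(mulfI _) => /(_ _)/invr_inj/addrI/oppr_inj; apply.
by rewrite subr_eq0 eq_sym.
Qed.

(** For y != 0 put x = t y in the first sum; the terms combine into chi t * chi ((1 - t y) / (1 -
    y)). Summing over y first leaves #|F| at t = 1, since chi and chi^2 sum to 0. *)
Lemma jacobi_norm : jacobi * econj jacobi = #|F|%:R.
Proof.
rewrite {2}/jacobi rmorph_sum mulr_sumr.
transitivity (\sum_(y | y != 0) \sum_t chi t * chi ((1 - t * y) / (1 - y))).
  rewrite [RHS]big_mkcond; apply: eq_bigr => y _.
  have [->|y0] /= := eqVneq y 0; first by rewrite cubic_char0 mul0r rmorph0 mulr0.
  rewrite /jacobi (reindex_inj (mulIf y0)) mulr_suml; apply: eq_bigr => t _.
  rewrite rmorphM /= -!cubic_charV -!(cubic_charM chiP); congr chi.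
  by rewrite -[RHS]mulr1 -(divff y0); ring.
rewrite exchange_big /=.
under eq_bigr => t _ do rewrite -mulr_sumr sum_cubic_char_moebius !mulrBr mulr1.
rewrite !sumrB (cubic_char_sum chiP) cubic_char_sumX2 !subr0.
rewrite (bigD1 1) //= eqxx cubic_char1 mul1r big1 ?addr0 // => t /negPf->.
by rewrite mulr0n mulr0.
Qed.

(** As chi sums to 0, the second coordinates of chi x and chi (1 - x) may be subtracted inside the
    sum; each term is then divisible by 3. *)
Lemma jacobi_mod3 : (3 %| eis2 jacobi)%Z.
Proof.
have eis2_sum (f : F -> eis) : eis2 (\sum_x f x) = \sum_x eis2 (f x).
  by apply: (big_morph eis2) => // -[a b] [c d].
have Sum0 : \sum_x eis2 (chi x) = 0 by rewrite -eis2_sum (cubic_char_sum chiP).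
have Sum0' : \sum_x eis2 (chi (1 - x)) = 0.
  rewrite -[RHS]Sum0 [RHS](reindex_inj (h := fun x => 1 - x)) //.
  by move=> x y /addrI/oppr_inj.
have -> : eis2 jacobi =
    \sum_x (eis2 (chi x * chi (1 - x)) - eis2 (chi x) - eis2 (chi (1 - x))).
  by rewrite 2!sumrB Sum0 Sum0' !subr0 /jacobi eis2_sum.
apply: rpred_sum => x _.
have [->|x0] := eqVneq x 0; first by rewrite subr0 cubic_char0 cubic_char1.
have [->|x1] := eqVneq x 1; first by rewrite subrr cubic_char0 cubic_char1.
by apply: cubic_values_mod3; rewrite ?(cubic_char_val chiP) ?(cubic_char_eq0 chiP) //
  subr_eq0 eq_sym.
Qed.
End CubicCharacter.

(** * Power sums over finite fields and the cubic character of ['F_p] *)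

Lemma natr_card_eq0 (F : finFieldType) : (#|F|%:R : F) = 0.
Proof.
have : \sum_(x : F) x = \sum_(x : F) (x + 1) by rewrite (reindex_inj (addIr 1)).
by rewrite big_split /= sumr_const -[LHS]addr0 => /addrI <-.
Qed.

(** Substituting g x multiplies the sum by g^k, and some g has g^k != 1. *)
Lemma sum_expr_eq0 (F : finFieldType) (k : nat) : (k.+1 < #|F|)%N ->
  \sum_(x : F) x ^+ k = 0.
Proof.
case: k => [_|k kF].
  (* With 0^0 = 1 the sum is #|F|, which is 0 in F. *)
  by under eq_bigr do rewrite expr0; rewrite sumr_const -[RHS](natr_card_eq0 F).
have [g g0 gk] := finField_expr_neq1 (isT : (0 < k.+1)%N) kF.
have : \sum_(x : F) x ^+ k.+1 = g ^+ k.+1 * \sum_(x : F) x ^+ k.+1.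
  rewrite mulr_sumr {1}(reindex_inj (mulfI g0)).
  by apply: eq_bigr => x _; rewrite exprMn.
move/eqP; rewrite -subr_eq0 -{1}[\sum_x _]mul1r -mulrBl mulf_eq0 subr_eq0 eq_sym.
by rewrite (negPf gk) => /eqP.
Qed.

Lemma expr_card_pred (F : finFieldType) (x : F) : x != 0 -> x ^+ #|F|.-1 = 1.
Proof.
move=> x0; apply: (mulfI x0); rewrite -exprS prednK ?mulr1 ?expf_card //.
by apply/card_gt0P; exists x.
Qed.

Lemma sum_expr_card_pred (F : finFieldType) : \sum_(x : F) x ^+ #|F|.-1 = - 1.
Proof.
have F1 := finRing_gt1 F.
rewrite (bigD1 0) //= expr0n gtn_eqF ?add0r; last by rewrite -ltnS prednK // ltnW.
rewrite (eq_bigr (fun=> 1)) => [|x /expr_card_pred //].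
have := natr_card_eq0 F; rewrite -sumr_const (bigD1 0) //= addrC => /eqP.
by rewrite addr_eq0 => /eqP.
Qed.

Lemma sum_exprM_1B (F : finFieldType) (a b : nat) :
  \sum_(x : F) x ^+ a * (1 - x) ^+ b =
  \sum_(i < b.+1) (- 1) ^+ i * 'C(b, i)%:R * \sum_(x : F) x ^+ (a + i).
Proof.
under eq_bigr do rewrite exprBn mulr_sumr.
rewrite exchange_big; apply: eq_bigr => i _ /=; rewrite mulr_sumr.
by apply: eq_bigr => x _; rewrite expr1n mulr1 exprD -mulr_natr; ring.
Qed.

(* Wilson's theorem turns 'C(2 m, m) into an inverse cube modulo 3 m + 1. *)
Lemma bin_cube_Fp (p m : nat) : prime p -> p = (3 * m).+1 ->
  - (- 1) ^+ m * 'C(2 * m, m)%:R * (m`!)%:R ^+ 3 = 1 :> 'F_p.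
Proof.
move=> pp pm; have pF := pchar_Fp pp.
have W : ((3 * m)`!)%:R = - 1 :> 'F_p.
  apply/eqP; rewrite -addr_eq0 natr1 -(dvdn_pcharf pF).
  by have := Wilson (prime_gt1 pp); rewrite pp {2}pm => <-.
(* The factor 3 m - i is - (i + 1) modulo p. *)
have E1 : ((3 * m) ^_ m)%:R = (- 1) ^+ m * (m`!)%:R :> 'F_p.
  rewrite ffact_prod fact_prod big_add1 /= big_mkord !natr_prod.
  rewrite -[m in (- 1) ^+ m]card_ord -prodr_const -big_split /=.
  apply: eq_bigr => i _; apply/eqP; rewrite mulN1r -addr_eq0 -natrD -(dvdn_pcharf pF).
  by rewrite pm; apply/dvdnP; exists 1%N; have := ltn_ord i; lia.
have F1 : ('C(2 * m, m) * (m`! * m`!))%N = (2 * m)`!.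
  by rewrite -(@bin_fact (2 * m) m) ?leq_pmull // mul2n -addnn addnK.
have F2 : ((3 * m) ^_ m * (2 * m)`!)%N = (3 * m)`!.
  by rewrite -(@ffact_fact (3 * m) m) ?leq_pmull // (mulnDl 1 2) mul1n addKn.
move: W; rewrite -F2 -F1 !natrM E1 => W; rewrite -[RHS]opprK -[X in _ = - X]W; ring.
Qed.

(** chi x is the value in [cubic_values] that reduces to x^m. It is multiplicative because reduction
    is injective on these values. *)
Lemma cubic_character_Fp (p m : nat) : prime p -> p = (3 * m).+1 ->
  exists (w : 'F_p) (chi : 'F_p -> eis),
  [/\ w ^+ 2 + w + 1 = 0, cubic_character chi & forall x, eis_eval w (chi x) = x ^+ m].
Proof.
move=> pp pm; have pF := pchar_Fp pp.
have cF : #|'F_p| = (3 * m).+1 by rewrite card_Fp.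
have [g g0 Ew] := finField_cube_root cF.
set w := g ^+ m in Ew.
have m0 : (0 < m)%N by have := prime_gt1 pp; lia.
have n3 : (3 : 'F_p) != 0.
  by rewrite -(dvdn_pcharf pF) dvdn_prime2 //; apply/eqP; lia.
pose chi (x : 'F_p) : eis := if x == 0 then 0 else
  if x ^+ m == 1 then 1 else if x ^+ m == w then omega else omega ^+ 2.
have evM := eis_evalM Ew.
have ev1 : eis_eval w 1 = 1 by rewrite /eis_eval mul0r addr0.
have evo : eis_eval w omega = w by rewrite /eis_eval add0r mul1r.
have ev0 : eis_eval w 0 = 0 by rewrite /eis_eval mul0r addr0.
have Vchi x : chi x \in cubic_values.
  by rewrite /chi; do ?case: ifP => _; rewrite !inE eqxx ?orbT.
have evchi x : eis_eval w (chi x) = x ^+ m.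
  rewrite /chi; have [->|x0] := eqVneq x 0; first by rewrite ev0 expr0n gtn_eqF.
  have [->//|x1] := eqVneq (x ^+ m) 1; have [->//|xw] := eqVneq (x ^+ m) w.
  rewrite expr2 evM evo; have := expr_card_pred x0; rewrite cF /= mulnC exprM => x3.
  have : (x ^+ m - 1) * ((x ^+ m - w) * (x ^+ m - w * w)) = 0.
    move: (x ^+ m) x3 => z z3.
    transitivity ((z ^+ 3 - 1) + (w ^+ 2 + w + 1) *
      ((z - 1) * (w - 1) - (z - 1) * z)); first by ring.
    by rewrite z3 Ew; ring.
  move/eqP; rewrite !mulf_eq0 !subr_eq0 (negPf x1) (negPf xw) /=.
  by move/eqP.
have inj : {in cubic_values &, forall u v, eis_eval w u = eis_eval w v -> u = v}.
  move=> u v uV vV E; apply/eqP; apply: contraT => /(cubic_values_sub uV vV) H.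
  have : eis_eval w ((u - v) * econj (u - v)) = 0.
    rewrite evM; apply/eqP; rewrite mulf_eq0; apply/orP; left.
    by rewrite eis_evalD E -eis_evalD subrr ev0.
  rewrite mul_econj /eis_eval mul0r addr0 /= => /eqP.
  by move: H; rewrite !inE => /orP[]/eqP->; rewrite ?oner_eq0 // (negPf n3).
have chiM : {morph chi : x y / x * y}.
  move=> x y; apply: inj => //; first exact: cubic_values_mul.
  by rewrite evM !evchi exprMn.
exists w, chi; split=> //; split=> // [x|].
  rewrite /chi; case: ifP => // _; by do ?case: ifP => _.
(* Multiplication by g permutes the field; chi g = 1 would give w = g^m = 1. *)
have /eis_mulI[E|//] : (chi g - 1) * \sum_x chi x = 0.
  rewrite mulrBl mul1r mulr_sumr [X in _ - X](reindex_inj (mulfI g0)) -sumrB big1 // => x _.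
  by rewrite chiM subrr.
have : w = 1.
  have /eqP := E; rewrite subr_eq0 => /eqP E1.
  by rewrite -ev1 -E1 evchi.
move=> w1; case/eqP: n3; rewrite -[RHS]Ew w1; ring.
Qed.

(* With J the Jacobi sum of the cubic character chi, chi x = x^m modulo the
   prime above p at hand, so J reduces to sum x^m (1-x)^m = 0 and its conjugate
   to sum x^(2m) (1-x)^(2m) = - (-1)^m 'C(2m, m) = 1 / (m!)^3. *)
Lemma primary_prime_conj_cube (p m : nat) : prime p -> p = (3 * m).+1 ->
  exists (x : eis) (w c : 'F_p),
  [/\ x * econj x = p%:R, (3 %| eis2 x)%Z, w ^+ 2 + w + 1 = 0,
      eis_eval w x = 0 & eis_eval (w ^+ 2) x = c ^+ 3].
Proof.
move=> pp pm; have [w [chi [Ew chiP evchi]]] := cubic_character_Fp pp pm.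
have cF : #|'F_p| = (3 * m).+1 by rewrite card_Fp.
exists (jacobi chi), w, (m`!)%:R^-1; split => //.
- by rewrite jacobi_norm // card_Fp.
- exact: jacobi_mod3.
- rewrite eis_eval_sum.
  under eq_bigr do rewrite eis_evalM // !evchi.
  rewrite sum_exprM_1B big1 // => i _; rewrite sum_expr_eq0 ?mulr0 // cF.
  by have := ltn_ord i; have := prime_gt1 pp; lia.
- have ev2 x : eis_eval (w ^+ 2) (chi x) = x ^+ (2 * m).
    rewrite -eis_eval_conj // cubic_values_conj ?(cubic_char_val chiP) // expr2 eis_evalM //.
    by rewrite evchi mul2n -addnn exprD.
  have Ew2 : (w ^+ 2) ^+ 2 + w ^+ 2 + 1 = 0.
    by rewrite (_ : _ + 1 = (w ^+ 2 + w + 1) * (w ^+ 2 - w + 1)); [rewrite Ew mul0r|ring].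
  have f0 : (m`!)%:R != 0 :> 'F_p.
    apply: contra_eq_neq (bin_cube_Fp pp pm) => ->.
    by rewrite expr0n mulr0 eq_sym oner_eq0.
  have m2 : (m < (2 * m).+1)%N by lia.
  rewrite eis_eval_sum.
  under eq_bigr do rewrite eis_evalM // !ev2.
  (* The exponent 2 m + i is p - 1 only for i = m. For i < m the power sum vanishes; for i > m the
     exponent may be lowered to i - m, between 1 and m, and the sum vanishes too. *)
  rewrite sum_exprM_1B (bigD1 (Ordinal m2)) //= [X in _ + X]big1 => [|i im].
    have -> : (2 * m + m)%N = #|'F_p|.-1 by rewrite cF /=; lia.
    rewrite sum_expr_card_pred addr0 exprVn; apply: (mulIf (expf_neq0 3 f0)).
    by rewrite mulVf ?expf_neq0 // -[RHS](bin_cube_Fp pp pm); ring.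
  have {}im : (i != m :> nat) by [].
  have [lt|gt] : (i < m)%N \/ (m < i)%N by lia.
    by rewrite sum_expr_eq0 ?mulr0 // cF; lia.
  rewrite (eq_bigr (fun x => x ^+ (i - m))) => [|x _].
    by rewrite sum_expr_eq0 ?mulr0 // cF; have := ltn_ord i; lia.
  rewrite (_ : 2 * m + i = #|'F_p|.-1 + (i - m))%N; last by rewrite cF; lia.
  have [->|x0] := eqVneq x 0.
    have im0 : (0 < i - m)%N by rewrite subn_gt0.
    by rewrite exprD [0 ^+ (i - m)]expr0n (gtn_eqF im0) mulr0.
  by rewrite exprD expr_card_pred ?mul1r.
Qed.

(** * Residues of primary elements *)

Lemma cube_root1_sqr (R : comNzRingType) (w : R) : w ^+ 2 + w + 1 = 0 ->
  (w ^+ 2) ^+ 2 = w /\ (w ^+ 2) ^+ 2 + w ^+ 2 + 1 = 0.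
Proof.
move=> Ew; have E4 : (w ^+ 2) ^+ 2 = w.
  by rewrite -exprM exprSr cube_root1 // mul1r.
by split=> //; rewrite E4 -Ew; ring.
Qed.

Lemma coprimez_comb (a b c d s t u v : int) : coprimez a b ->
  a = s * c + t * d -> b = u * c + v * d -> coprimez c d.
Proof.
move=> /coprimezP[[x y] /= E] Ea Eb; apply/coprimezP.
exists (x * s + y * u, x * t + y * v) => /=; rewrite -E Ea Eb; ring.
Qed.

(** The two primes above p are distinct, so an element of both is divisible by p. *)
Lemma eis_eval_eq0 (p : nat) (w : 'F_p) (a b : int) : prime p -> (3 : 'F_p) != 0 ->
  w ^+ 2 + w + 1 = 0 -> eis_eval w (Eis a b) = 0 -> eis_eval (w ^+ 2) (Eis a b) = 0 ->
  (p %| a)%Z /\ (p %| b)%Z.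
Proof.
move=> pp n3 Ew; rewrite /eis_eval /= => E1 E2.
have b0 : b%:~R = 0 :> 'F_p.
  have : b%:~R * (w - w ^+ 2) = 0 :> 'F_p.
    by rewrite -[RHS](subrr 0) -{1}E1 -E2; ring.
  move/eqP; rewrite mulf_eq0 => /orP[/eqP //|].
  by rewrite -sqrf_eq0 cube_root1_sub // oppr_eq0 (negPf n3).
by rewrite !(dvdz_pcharf (pchar_Fp pp)) b0 -E1 b0 mul0r addr0.
Qed.

Lemma eis_eval_norm (p : nat) (w : 'F_p) (a b : int) : w ^+ 2 + w + 1 = 0 ->
  eis_eval w (Eis a b) * eis_eval (w ^+ 2) (Eis a b) = (a ^+ 2 - a * b + b ^+ 2)%:~R.
Proof.
move=> Ew; rewrite -eis_eval_conj // -eis_evalM // mul_econj.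
by rewrite /eis_eval mul0r addr0.
Qed.

(** Induction on i: the primary prime x is divided out of a + b omega, each time contributing the
    cube c^3 to the residue at w^2. For i = 0 the primary element left is a cube. *)
Lemma primary_conj_cube_step (p i : nat) (x : eis) (w c : 'F_p) (a b v : int) :
  prime p -> (3 : 'F_p) != 0 -> x * econj x = p%:R -> (3 %| eis2 x)%Z ->
  w ^+ 2 + w + 1 = 0 -> eis_eval w x = 0 -> eis_eval (w ^+ 2) x = c ^+ 3 ->
  coprimez a b -> ~~ (3 %| a)%Z -> (3 %| b)%Z ->
  a ^+ 2 - a * b + b ^+ 2 = p%:Z ^+ i * v ^+ 3 ->
  eis_eval (w ^+ 2) (Eis a b) != 0 -> exists d, eis_eval (w ^+ 2) (Eis a b) = d ^+ 3.
Proof.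
move=> pp n3 xx x3 Ew xw xw2; have [w4 Ew2] := cube_root1_sqr Ew.
elim: i a b => [|i IHi] a b cab a3 b3 N ev2.
  have [|r [s [Ea Eb]]] := primary_norm_cube cab a3 b3 (v := v).
    by rewrite N expr0 mul1r.
  exists (eis_eval (w ^+ 2) (Eis r s)).
  have -> : Eis a b = Eis r s * (Eis r s * Eis r s).
    by rewrite Ea Eb !eisE; congr Eis; ring.
  by rewrite !(eis_evalM Ew2) -expr2 -exprS.
have ev1 : eis_eval w (Eis a b) = 0.
  have /eqP := eis_eval_norm a b Ew; rewrite N [p%:Z ^+ _]exprS.
  have /eqP p0 : p%:Z%:~R == 0 :> 'F_p by rewrite -(dvdz_pcharf (pchar_Fp pp)).
  by rewrite -mulrA intrM p0 mul0r mulf_eq0 (negPf ev2) orbF => /eqP.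
have [e [f Ef]] : exists e f, Eis a b * econj x = Eis e f.
  by case: (_ * _) => e f; exists e, f.
(* The product with conj x lies in both primes above p, so p = x conj x divides it and x divides a +
   b omega. *)
have [pe pf] : (p %| e)%Z /\ (p %| f)%Z.
  apply: (@eis_eval_eq0 p w) => //; rewrite -Ef; first by rewrite eis_evalM // ev1 mul0r.
  by rewrite eis_evalM // eis_eval_conj // w4 xw mulr0.
case/dvdzP: pe => a' Ee; case/dvdzP: pf => b' Eff.
have pN0 : p%:Z != 0 by have := prime_gt0 pp; lia.
have px : (p%:R : eis) = Eis p 0 by rewrite -[p%:R]/(p%:~R) eis_int.
have Eab : Eis a b = x * Eis a' b'.
  have /eis_mulI[/eqP|E] : (Eis a b - x * Eis a' b') * econj x = 0.
  - rewrite mulrBl Ef mulrAC xx px !eisE Ee Eff; congr Eis => /=; ring.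
  - by rewrite subr_eq0 => /eqP.
  by move: xx pN0; rewrite E mulr0 px => -[<-].
case: x Eab xx x3 xw xw2 px Ef => x1 x2 Eab xx x3 xw xw2 px Ef.
have [Ea Eb] : a = x1 * a' - x2 * b' /\ b = x1 * b' + x2 * a' - x2 * b'.
  by move: Eab; rewrite eisE => -[].
have Nx : x1 ^+ 2 - x1 * x2 + x2 ^+ 2 = p.
  by move: xx; rewrite mul_econj px => -[].
have cab' : coprimez a' b'.
  apply: (coprimez_comb (s := x1) (t := - x2) (u := x2) (v := x1 - x2) cab).
    by rewrite Ea; ring.
  by rewrite Eb; ring.
have x13 : ~~ (3 %| x1)%Z.
  apply: contra n3 => x13; rewrite -(dvdn_pcharf (pchar_Fp pp)) dvdn_prime2 //.
  rewrite eq_sym -dvdn_prime2 // -[(_ %| _)%N]/(3 %| p%:Z)%Z -Nx.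
  by rewrite rpredD ?rpredB ?dvdz_exp // dvdz_mulr.
have b3' : (3 %| b')%Z.
  have : (3 %| x1 * b')%Z.
    have -> : x1 * b' = b - x2 * a' + x2 * b' by rewrite Eb; ring.
    by rewrite rpredD ?rpredB // dvdz_mulr.
  by rewrite Gauss_dvdzr // coprimezE prime_coprime // -dvdzE.
have a3' : ~~ (3 %| a')%Z.
  by apply: contra a3 => a3'; rewrite Ea rpredB // ?dvdz_mull // dvdz_mulr.
have evx : eis_eval (w ^+ 2) (Eis a b) = c ^+ 3 * eis_eval (w ^+ 2) (Eis a' b').
  by rewrite Eab eis_evalM // xw2.
have [||d Ed] := IHi a' b' cab' a3' b3'.
- apply: (mulfI pN0); rewrite mulrA -exprS -N -Nx Ea Eb; ring.
- by move: ev2; rewrite evx mulf_eq0 negb_or => /andP[].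
by exists (c * d); rewrite evx Ed exprMn.
Qed.

(** As p divides the norm, a + b omega lies in one prime above p, and by coprimality not in both. If
    it is the conjugate prime, the previous lemma applies to the conjugate element, and w^2 takes
    the place of w. *)
Lemma primary_conj_cube (p m i : nat) (a b v : int) : prime p -> p = (3 * m).+1 ->
  coprimez a b -> ~~ (3 %| a)%Z -> (3 %| b)%Z ->
  a ^+ 2 - a * b + b ^+ 2 = p%:Z ^+ i.+1 * v ^+ 3 ->
  exists w d : 'F_p, [/\ w ^+ 2 + w + 1 = 0, a%:~R + b%:~R * w = 0,
    a%:~R + b%:~R * w ^+ 2 = d ^+ 3 & d != 0].
Proof.
move=> pp pm cab a3 b3 N.
have [x [w [c [xx x3 Ew xw xw2]]]] := primary_prime_conj_cube pp pm.
have n3 : (3 : 'F_p) != 0.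
  by rewrite -(dvdn_pcharf (pchar_Fp pp)) dvdn_prime2 //; apply/eqP; lia.
have [w4 Ew2] := cube_root1_sqr Ew.
have nz (d : 'F_p) : d ^+ 3 != 0 -> d != 0 by rewrite expf_eq0.
have step := primary_conj_cube_step pp n3 xx x3 Ew xw xw2.
have ev : eis_eval w (Eis a b) * eis_eval (w ^+ 2) (Eis a b) = 0.
  rewrite (eis_eval_norm a b Ew) N [p%:Z ^+ _]exprS.
  have /eqP p0 : p%:Z%:~R == 0 :> 'F_p by rewrite -(dvdz_pcharf (pchar_Fp pp)).
  by rewrite -mulrA intrM p0 mul0r.
have [ev2|ev2] := eqVneq (eis_eval (w ^+ 2) (Eis a b)) 0; last first.
  have [d Ed] := step _ _ _ _ cab a3 b3 N ev2.
  exists w, d; split=> //; last by apply: nz; rewrite -Ed.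
  by move/eqP: ev; rewrite mulf_eq0 (negPf ev2) orbF => /eqP.
have cN : eis_eval (w ^+ 2) (Eis (a - b) (- b)) = eis_eval w (Eis a b).
  have := eis_eval_conj (Eis a b) Ew2; by rewrite w4.
have ev1 : eis_eval w (Eis a b) != 0.
  apply/negP => /eqP ev1; have [pa pb] := eis_eval_eq0 pp n3 Ew ev1 ev2.
  have : (p %| gcdz a b)%Z by rewrite dvdz_gcd pa.
  by move/eqP: cab => ->; rewrite dvdz1 /=; have := prime_gt1 pp; lia.
have [|||||d Ed] := step i.+1 (a - b) (- b) v.
- by apply: (coprimez_comb (s := 1) (t := - 1) (u := 0) (v := - 1) cab); ring.
- by rewrite rpredBr.
- by rewrite rpredN.
- by rewrite -N; ring.
- by rewrite cN.
rewrite cN in Ed.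
exists (w ^+ 2), d; split => //; last by apply: nz; rewrite -Ed.
by rewrite w4.
Qed.

(** Since 3 (2 k + 1) = 2 (l - 1) + 1, this power inverts cubing, which is therefore injective. *)
Lemma expf_cube_inj_power (l k : nat) (x : 'F_l) : prime l -> l = (3 * k + 2)%N ->
  (x ^+ 3) ^+ (2 * k + 1) = x.
Proof.
move=> pl lk; have [->|x0] := eqVneq x 0.
  by rewrite -exprM expr0n; case: eqP => //; lia.
rewrite -exprM (_ : 3 * (2 * k + 1) = #|'F_l|.-1 * 2 + 1)%N; last first.
  by rewrite card_Fp // lk; lia.
by rewrite exprD exprM expr_card_pred // expr1n mul1r.
Qed.

(** If l divides the norm then a^3 = (-b)^3 modulo l, so a = -b and the norm is 3 b^2; then l
    divides both a and b. *)
Lemma inert_ndvd_norm (l k : nat) (a b : int) : prime l -> l = (3 * k + 2)%N ->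
  coprimez a b -> ~~ (l %| a ^+ 2 - a * b + b ^+ 2)%Z.
Proof.
move=> pl lk cab; apply/negP; rewrite !(dvdz_pcharf (pchar_Fp pl)) => /eqP E.
have E' : (a%:~R : 'F_l) ^+ 2 - a%:~R * b%:~R + b%:~R ^+ 2 = 0 by rewrite -[RHS]E; ring.
have Eab : (a%:~R : 'F_l) = - b%:~R.
  rewrite -[LHS](expf_cube_inj_power _ pl lk) -[RHS](expf_cube_inj_power _ pl lk).
  congr (_ ^+ _); apply/eqP; rewrite -subr_eq0.
  by rewrite -(mulr0 (a%:~R + b%:~R)) -E'; apply/eqP; ring.
have n3 : (3 : 'F_l) != 0.
  by rewrite -(dvdn_pcharf (pchar_Fp pl)) dvdn_prime2 //; apply/eqP; lia.
have b0 : (b%:~R : 'F_l) = 0.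
  have /eqP : 3 * (b%:~R : 'F_l) ^+ 2 = 0 by rewrite -[RHS]E' Eab; ring.
  by rewrite mulf_eq0 (negPf n3) sqrf_eq0 => /eqP.
have : (l %| gcdz a b)%Z.
  by rewrite dvdz_gcd !(dvdz_pcharf (pchar_Fp pl)) Eab b0 oppr0 eqxx.
by move/eqP: cab => ->; rewrite dvdz1 /=; have := prime_gt1 pl; lia.
Qed.

Lemma is_cube_mod_Fp (p l j : nat) (d : 'F_p) : prime p -> ~~ (p %| l)%N ->
  (0 < j < 3)%N -> d ^+ 3 = l%:R ^+ j -> is_cube_mod p l.
Proof.
move=> pp pl j3 E.
have l0 : (l%:R : 'F_p) != 0 by rewrite -(dvdn_pcharf (pchar_Fp pp)).
have [e Ee] : exists e : 'F_p, e ^+ 3 = l%:R.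
  case: j j3 E => [|[|[|j]]] // _ E; first by exists d.
  (* For j = 2, d^6 / l^3 = l^4 / l^3 = l. *)
  exists (d ^+ 2 / l%:R); rewrite exprMn exprVn -exprM mulnC exprM E.
  by rewrite -!exprM; apply: (mulIf (expf_neq0 3 l0)); rewrite divfK ?expf_neq0 // -exprS.
by exists (val e); rewrite -!val_Fp_nat // natrX natr_Zp Ee.
Qed.

(** * Descent *)

Lemma cubez_inj (a b : int) : a ^+ 3 = b ^+ 3 -> a = b.
Proof.
move=> E; have : (a - b) * ((2 * a + b) ^+ 2 + 3 * b ^+ 2) = 0.
  by transitivity (4 * (a ^+ 3 - b ^+ 3)); [|rewrite E]; ring.
move/eqP; rewrite mulf_eq0 => /orP[/eqP|]; first by lia.
move=> /eqP S0; have [/eqP E1 /eqP E2] : (2 * a + b) ^+ 2 = 0 /\ b ^+ 2 = 0.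
  move: S0 (sqr_ge0 (2 * a + b)) (sqr_ge0 b).
  by move: (_ ^+ 2) (b ^+ 2) => A B; lia.
by move: E1 E2; rewrite !sqrf_eq0 => /eqP E1 /eqP E2; lia.
Qed.

(** The same gcd argument over the integers, where both units are cubes. *)
Lemma coprimez_mul_cube (a b z : int) : coprimez a b -> a * b = z ^+ 3 ->
  exists u v, [/\ a = u ^+ 3, b = v ^+ 3 & z = u * v].
Proof.
move=> cab E.
have cube (x y : int) : coprimez x y -> x * y = z ^+ 3 -> exists u, x = u ^+ 3.
  move=> /coprimezP[[s t] /= Bez] Exy; have [a' [b' Ed]] := Bezoutz x z.
  have [x0|x0] := eqVneq x 0; first by exists 0; rewrite x0 expr0n.
  have /dvdzP[x' Ex] := dvdz_gcdl x z; have /dvdzP[z' Ez] := dvdz_gcdr x z.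
  have [u [v [Eu Ev]]] := gcd_cube_assoc Exy Bez (esym Ed) Ex Ez.
  have uv : u * v = 1.
    by apply: (mulIf x0); rewrite mul1r -mulrA -Ev -Eu.
  have : (u %| 1)%Z by apply/dvdzP; exists v; rewrite mulrC.
  rewrite dvdz1 => /eqP u1.
  have [{}u1|{}u1] : u = 1 \/ u = -1 by lia.
    by exists (gcdz x z); rewrite [LHS]Eu u1 mul1r.
  by exists (- gcdz x z); rewrite [LHS]Eu u1; ring.
have [u Eu] := cube _ _ cab E.
have [v Ev] : exists v, b = v ^+ 3.
  by apply: (cube b a); rewrite 1?mulrC // coprimez_sym.
by exists u, v; split=> //; apply: cubez_inj; rewrite -E Eu Ev exprMn.
Qed.

Lemma prime_pow_dvdz_coprime (l i : nat) (a b : int) : prime l -> coprimez a b ->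
  (l%:Z ^+ i %| a * b)%Z -> (l%:Z ^+ i %| a)%Z \/ (l%:Z ^+ i %| b)%Z.
Proof.
move=> pl cab H.
have cl (x : int) : ~~ (l %| x)%Z -> coprimez (l%:Z ^+ i) x.
  by move=> lx; rewrite coprimezXl // coprimezE prime_coprime // -dvdzE.
have [la|la] := boolP (l %| a)%Z.
  left; rewrite -(Gauss_dvdzl _ (cl b _)) //; apply/negP => lb.
  have : (l %| gcdz a b)%Z by rewrite dvdz_gcd la.
  by move/eqP: cab => ->; rewrite dvdz1 /=; have := prime_gt1 pl; lia.
by right; rewrite -(Gauss_dvdzr _ (cl a la)).
Qed.

(** The bound is by the factor u of the old z; strict descent comes from the cofactor. *)
Definition cube_sum_below (n u : int) : Prop :=
  exists X Y Z, [/\ coprimez X Y, X ^+ 3 + Y ^+ 3 = n * Z ^+ 3, Z != 0 & `|Z| <= `|u|].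

(** The outcome where P and Q divide different linear forms. *)
Definition twisted_fermat (P Q : int) : Prop :=
  exists X Y Z, P * X ^+ 3 + Q * Y ^+ 3 + Z ^+ 3 = 0 /\ coprimez (P * X ^+ 3) (Q * Y ^+ 3).

Lemma coprimezMl_inv (a b c : int) : coprimez (a * b) c -> coprimez a c /\ coprimez b c.
Proof. by rewrite !(coprimez_sym _ c) coprimezMr => /andP[]. Qed.

(** The zero sum makes the factors pairwise coprime, so P and Q each divide one of them, and what
    remains are cubes. If P and Q divide the same factor, the zero sum is a new solution; otherwise
    it is the twisted equation. *)
Lemma triple_split (l1 l2 i j : nat) (p q r u : int) : prime l1 -> prime l2 -> l1 != l2 ->
  p + q + r = 0 -> coprimez p q -> p * q * r = l1%:Z ^+ i * l2%:Z ^+ j * u ^+ 3 -> u != 0 ->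
  cube_sum_below (l1%:Z ^+ i * l2%:Z ^+ j) u \/ twisted_fermat (l1%:Z ^+ i) (l2%:Z ^+ j).
Proof.
move=> p1 p2 l12; set P := l1%:Z ^+ i; set Q := l2%:Z ^+ j => S0 cpq E u0.
have P0 : P != 0 by rewrite expf_neq0 //; have := prime_gt0 p1; lia.
have Q0 : Q != 0 by rewrite expf_neq0 //; have := prime_gt0 p2; lia.
have cpr (a b c : int) : a + b + c = 0 -> coprimez a b -> coprimez a c.
  by move=> Ec cab; apply: (coprimez_comb (s := 1) (t := 0) (u := - 1) (v := - 1) cab); lia.
have key (a b c : int) : a + b + c = 0 -> coprimez a b -> a * b * c = P * Q * u ^+ 3 ->
    (P %| a)%Z -> cube_sum_below (P * Q) u \/ twisted_fermat P Q.
  move=> {}S0 cab {}E /dvdzP[a' Ea].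
  have cac := cpr _ _ _ S0 cab.
  have cbc : coprimez b c by apply: (cpr b a c); [lia | rewrite coprimez_sym].
  have {}E : a' * (b * c) = Q * u ^+ 3 by apply: (mulfI P0); rewrite [RHS]mulrA -E Ea; ring.
  have [ca'b _] : coprimez a' b /\ coprimez P b by apply: coprimezMl_inv; rewrite -Ea.
  have [ca'c _] : coprimez a' c /\ coprimez P c by apply: coprimezMl_inv; rewrite -Ea.
  have ca'bc : coprimez a' (b * c) by rewrite coprimezMr ca'b.
  have QE : (Q %| a' * (b * c))%Z by rewrite E dvdz_mulr.
  have sub (e f g : int) : coprimez e (f * g) -> coprimez f g -> e * (f * g) = u ^+ 3 ->
      exists X Y Z, [/\ e = X ^+ 3, f = Y ^+ 3, g = Z ^+ 3 & u = X * (Y * Z)].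
    move=> ce cfg Eu; have [X [W [-> EW ->]]] := coprimez_mul_cube ce Eu.
    have [Y [Z [-> -> ->]]] := coprimez_mul_cube cfg EW.
    by exists X, Y, Z.
  case: (prime_pow_dvdz_coprime p2 ca'bc QE) =>
    [/dvdzP[a'' Ea']|/(prime_pow_dvdz_coprime p2 cbc)[]/dvdzP].
  - have [ca''bc _] : coprimez a'' (b * c) /\ coprimez Q (b * c).
      by apply: coprimezMl_inv; rewrite -Ea'.
    have [|X [Y [Z [EX EY EZ Eu]]]] := sub _ _ _ ca''bc cbc.
      by apply: (mulfI Q0); rewrite -E Ea'; ring.
    left; exists Y, Z, (- X); split.
    + by move: cbc; rewrite EY EZ coprimez_pexpl ?coprimez_pexpr.
    + by rewrite -EY -EZ -[LHS]subr0 -S0 Ea Ea' EX; ring.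
    + by rewrite oppr_eq0; apply: contra_neq u0 => X0; rewrite Eu X0 mul0r.
    + rewrite normrN Eu normrM ler_peMr // -gtz0_ge1 normr_gt0.
      by apply: contra_neq u0 => W0; rewrite Eu W0 mulr0.
  - move=> [b' Eb]; right.
    have [ca'b' _] : coprimez b' a' /\ coprimez Q a'.
      by apply: coprimezMl_inv; rewrite -Eb coprimez_sym.
    have [cb'c _] : coprimez b' c /\ coprimez Q c by apply: coprimezMl_inv; rewrite -Eb.
    have [|||X [Y [Z [EX EY EZ Eu]]]] := sub a' b' c.
    + by rewrite coprimezMr coprimez_sym ca'b'.
    + by [].
    + by apply: (mulfI Q0); rewrite -E Eb; ring.
    exists X, Y, Z; rewrite -EX -EY -EZ [P * _]mulrC [Q * _]mulrC -Ea -Eb; split=> //.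
  - move=> [c' Ec]; right.
    have [ca'c' _] : coprimez c' a' /\ coprimez Q a'.
      by apply: coprimezMl_inv; rewrite -Ec coprimez_sym.
    have [cc'b _] : coprimez c' b /\ coprimez Q b.
      by apply: coprimezMl_inv; rewrite -Ec coprimez_sym.
    have [|||X [Y [Z [EX EY EZ Eu]]]] := sub a' c' b.
    + by rewrite coprimezMr coprimez_sym ca'c'.
    + by [].
    + by apply: (mulfI Q0); rewrite -E Ec; ring.
    exists X, Y, Z; rewrite -EX -EY -EZ [P * _]mulrC [Q * _]mulrC -Ea -Ec; split=> //.
    by rewrite -S0; ring.
have cpqr : coprimez p (q * r) by rewrite coprimezMr cpq (cpr p q r).
have cqr : coprimez q r by apply: (cpr q p r); [lia | rewrite coprimez_sym].
have PE : (P %| p * (q * r))%Z by rewrite mulrA E -mulrA dvdz_mulr.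
case: (prime_pow_dvdz_coprime p1 cpqr PE) => [|/(prime_pow_dvdz_coprime p1 cqr)[]].
- exact: (key p q r S0 cpq E).
- by apply: (key q p r); [lia | rewrite coprimez_sym | rewrite -E; ring].
- by apply: (key r q p); [lia | rewrite coprimez_sym | rewrite -E; ring].
Qed.

(** B will be a norm, which the inert prime l2 cannot divide; only the place of the power of l1 is
    then open. *)
Lemma split_prime_powers (l1 l2 i j : nat) (A B z : int) : prime l1 -> prime l2 -> l1 != l2 ->
  coprimez A B -> A * B = l1%:Z ^+ i * l2%:Z ^+ j * z ^+ 3 -> ~~ (l2 %| B)%Z ->
  exists u v, z = u * v /\
    ((A = l1%:Z ^+ i * l2%:Z ^+ j * u ^+ 3 /\ B = v ^+ 3) \/
     (A = l2%:Z ^+ j * u ^+ 3 /\ B = l1%:Z ^+ i * v ^+ 3)).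
Proof.
move=> p1 p2 l12; set P := l1%:Z ^+ i; set Q := l2%:Z ^+ j => cAB E l2B.
have P0 : P != 0 by rewrite expf_neq0 //; have := prime_gt0 p1; lia.
have Q0 : Q != 0 by rewrite expf_neq0 //; have := prime_gt0 p2; lia.
have cQB : coprimez Q B by rewrite coprimezXl // coprimezE prime_coprime // -dvdzE.
have /dvdzP[A' EA] : (Q %| A)%Z.
  by rewrite -(Gauss_dvdzl _ cQB) E mulrAC dvdz_mull.
have [cA'B _] : coprimez A' B /\ coprimez Q B by apply: coprimezMl_inv; rewrite -EA.
have {}E : A' * B = P * z ^+ 3 by apply: (mulfI Q0); rewrite mulrA [Q * A']mulrC -EA E; ring.
have PE : (P %| A' * B)%Z by rewrite E dvdz_mulr.
case: (prime_pow_dvdz_coprime p1 cA'B PE) => /dvdzP[C EC].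
  have [cCB _] : coprimez C B /\ coprimez P B by apply: coprimezMl_inv; rewrite -EC.
  have [|u [v [EU EV Ez]]] := coprimez_mul_cube (z := z) cCB.
    by apply: (mulfI P0); rewrite -E EC; ring.
  by exists u, v; split=> //; left; rewrite EA EC EU; split=> //; ring.
have [cCA _] : coprimez C A' /\ coprimez P A'.
  by apply: coprimezMl_inv; rewrite -EC coprimez_sym.
have [||u [v [EU EV Ez]]] := coprimez_mul_cube (z := z) (a := A') (b := C).
- by rewrite coprimez_sym.
- by apply: (mulfI P0); rewrite -E EC; ring.
by exists u, v; split=> //; right; rewrite EA EC EU EV; split=> //; ring.
Qed.

(** Cubes are 0, 1 or -1 modulo 9; explicit witnesses make the congruences linear for [lia]. *)
Lemma mul_cube_mod9 (n al x : int) : (9 %| n - al)%Z ->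
  exists k t e : int, [/\ n * x ^+ 3 = 9 * k + al * e, x = 3 * t + e & [\/ e = 0, e = 1 | e = - 1]].
Proof.
move=> /dvdzP[q Eq]; have -> : n = 9 * q + al by lia.
have [t [e [-> He]]] : exists t e : int, x = 3 * t + e /\ [\/ e = 0, e = 1 | e = - 1].
  exists ((x + 1) %/ 3)%Z, (((x + 1) %% 3)%Z - 1); split; first by lia.
  have : ((x + 1) %% 3)%Z = 0 \/ ((x + 1) %% 3)%Z = 1 \/ ((x + 1) %% 3)%Z = 2 by lia.
  by case=> [->|[->|->]]; [constructor 3 | constructor 1 | constructor 2].
exists (q * (3 * t + e) ^+ 3 + al * (3 * t ^+ 3 + 3 * t ^+ 2 * e + t * e ^+ 2)), t, e.
split=> //; have Ee : e ^+ 3 = e by case: He => ->.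
by rewrite -[X in _ = _ + al * X]Ee; ring.
Qed.

Lemma coprimez_addMl (a k c : int) : coprimez a c -> coprimez a (k * a + c).
Proof.
by move=> cac; apply: (coprimez_comb (s := 1) (t := 0) (u := - k) (v := 1) cac); ring.
Qed.

Lemma coprimez_prime (l : nat) (a b : int) : prime l -> coprimez a b ->
  (l %| a)%Z -> (l %| b)%Z -> False.
Proof.
move=> pl /eqP cab la lb; have : (l %| gcdz a b)%Z by rewrite dvdz_gcd la.
by rewrite cab dvdz1 /=; have := prime_gt1 pl; lia.
Qed.

(** Here x + y = 3 c, and x^3 + y^3 = 9 c N(a + c omega). Modulo 3 that norm is x^2, so it is c that
    absorbs the last factor 3 of z^3. *)
Lemma cube_sum_dvd3 (n x y z : int) : coprimez x y -> x ^+ 3 + y ^+ 3 = n * z ^+ 3 ->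
  (3 %| z)%Z -> exists a b z', [/\ coprimez a (3 * b), ~~ (3 %| a)%Z, z = 3 * z' &
    b * (a ^+ 2 - a * (3 * b) + (3 * b) ^+ 2) = n * z' ^+ 3].
Proof.
move=> cxy E /dvdzP[z' Ez].
have [k1 [t1 [e1 [Ex Ext He1]]]] := @mul_cube_mod9 1 1 x isT.
have [k2 [t2 [e2 [Ey Eyt He2]]]] := @mul_cube_mod9 1 1 y isT.
have En : n * z ^+ 3 = 27 * (n * z' ^+ 3) by rewrite Ez; ring.
have [c Ec] : exists c, x + y = 3 * c.
  exists (t1 + t2); move: E Ex Ey; rewrite En !mul1r => E Ex Ey.
  by rewrite Ex Ey in E; case: He1 => ?; case: He2 => ?; lia.
(* Chosen so that x + y omega = (1 - omega) (a + c omega). *)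
pose a := x - c.
have [Exa Eya] : x = a + c /\ y = 2 * c - a by rewrite /a; lia.
have Nc : c * (a ^+ 2 - a * c + c ^+ 2) = 3 * (n * z' ^+ 3).
  apply: (mulfI (_ : 9 != 0 :> int)) => //.
  transitivity (27 * (n * z' ^+ 3)); last by ring.
  by rewrite -En -E Exa Eya; ring.
have n3x : (3 %| x)%Z -> False.
  move=> x3; apply: (@coprimez_prime 3 _ _ isT cxy x3).
  by rewrite (_ : y = 3 * c - x) ?rpredB // ?dvdz_mulr //; lia.
have [b Eb] : exists b, c = 3 * b.
  have : (3 %| c * (a ^+ 2 - a * c + c ^+ 2))%Z by rewrite Nc dvdz_mulr.
  rewrite dvdzE abszM Euclid_dvdM // => /orP[].
    by rewrite -[(_ %| _)%N]/(3%Z %| c)%Z => /dvdzP[b ->]; exists b; rewrite mulrC.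
  rewrite -[(_ %| _)%N]/(3%Z %| a ^+ 2 - a * c + c ^+ 2)%Z => N3; case: n3x.
  have : (3 %| x ^+ 2)%Z.
    rewrite (_ : x ^+ 2 = (a ^+ 2 - a * c + c ^+ 2) + 3 * (a * c)); last by rewrite Exa; ring.
    by rewrite rpredD // dvdz_mulr.
  by rewrite !dvdzE abszX Euclid_dvdX // => /andP[].
exists a, b, z'; split.
- by rewrite -Eb; apply: (@coprimez_comb x y a c 1 1 (- 1) 2 cxy); lia.
- by apply/negP => a3; apply: n3x; rewrite Exa Eb rpredD // dvdz_mulr.
- by rewrite Ez mulrC.
- by apply: (mulfI (_ : 3 != 0 :> int)) => //; rewrite -Nc Eb; ring.
Qed.

(** Infinite descent on |z|. When 3 divides z and the norm is a cube, a + 3 b omega = (r + s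
    omega)^3 gives b = r s (r - s). The remaining situations are left to the hypotheses, settled
    separately for l1 inert or split. *)
Lemma cube_sum_descent (l1 l2 i j k : nat) (P := l1%:Z ^+ i) (Q := l2%:Z ^+ j) :
  prime l1 -> prime l2 -> l1 != l2 -> l2 = (3 * k + 2)%N ->
  (forall a b u v, coprimez a (3 * b) -> ~~ (3 %| a)%Z -> b = Q * u ^+ 3 ->
     a ^+ 2 - a * (3 * b) + (3 * b) ^+ 2 = P * v ^+ 3 -> False) ->
  (forall x y z, coprimez x y -> x ^+ 3 + y ^+ 3 = P * Q * z ^+ 3 -> ~~ (3 %| z)%Z ->
     exists X Y Z, [/\ coprimez X Y, X ^+ 3 + Y ^+ 3 = P * Q * Z ^+ 3, Z != 0 & `|Z| < `|z|]) ->
  ~ twisted_fermat P Q ->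
  forall x y z, coprimez x y -> x ^+ 3 + y ^+ 3 = P * Q * z ^+ 3 -> z = 0.
Proof.
move=> p1 p2 l12 l2k hB hA hT x y z.
have [N] := ubnP `|z|%N; elim: N x y z => // N IH x y z ltN cxy E.
apply/eqP; apply: contraT => z0.
have IH' X Y Z : [/\ coprimez X Y, X ^+ 3 + Y ^+ 3 = P * Q * Z ^+ 3, Z != 0 & `|Z| < `|z|] -> false.
  case=> cXY EXY Z0 lt; case/eqP: Z0; apply: (IH X Y Z) => //.
  by move: ltN lt; clear; lia.
have [z3|z3] := boolP (3 %| z)%Z; last first.
  by have [X [Y [Z /IH']]] := hA x y z cxy E z3.
have [a [b [z' [cab a3 Ez Eb]]]] := cube_sum_dvd3 cxy E z3.
have [||u [v [Ez' [[EA EB]|[EA EB]]]]] := split_prime_powers p1 p2 l12 _ Eb.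
- rewrite (_ : _ + _ = (9 * b - 3 * a) * b + a ^+ 2); last by ring.
  apply/coprimez_addMl/coprimezXr; rewrite coprimez_sym.
  by move: cab; rewrite coprimezMr => /andP[].
- exact: (inert_ndvd_norm p2 l2k cab).
- have [|r [s [Ea E3b]]] := primary_norm_cube cab a3 _ EB; first exact: dvdz_mulr.
  have {}E3b : b = r * s * (r - s).
    by apply: (mulfI (_ : 3 != 0 :> int)) => //; rewrite E3b; ring.
  have crs : coprimez r s.
    apply: (coprimez_comb (s := r ^+ 2) (t := s ^+ 2 - 3 * r * s)
      (u := 3 * s * (r - s)) (v := 0) cab).
      by rewrite Ea; ring.
    by rewrite E3b; ring.
  have u0 : u != 0 by apply: contra_neq z0 => u0; rewrite Ez Ez' u0; ring.
  have v0 : v != 0 by apply: contra_neq z0 => v0; rewrite Ez Ez' v0; ring.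
  (* The forms r, -s, s - r sum to 0 and multiply to b. *)
  have [|||[X [Y [Z [cXY EXY Z0 lt]]]]|//] :=
    triple_split (p := r) (q := - s) (r := s - r) p1 p2 l12 _ _ _ u0 (i := i) (j := j).
  + by ring.
  + by apply: (coprimez_comb (s := 1) (t := 0) (u := 0) (v := - 1) crs); ring.
  + by rewrite -EA E3b; ring.
  apply: (IH' X Y Z); split=> //; apply: le_lt_trans lt _.
  by rewrite Ez Ez'; move: u0 v0; clear; nia.
- by case: (hB a b u v).
Qed.

Lemma coprimez_add_norm (x y : int) : coprimez x y -> ~~ (3 %| x + y)%Z ->
  coprimez (x + y) (x ^+ 2 - x * y + y ^+ 2).
Proof.
move=> cxy n3; rewrite (_ : _ + y ^+ 2 = (x + y) * (x + y) + (- 3) * (x * y)); last by ring.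
apply: coprimez_addMl; rewrite !coprimezMr; apply/and3P; split.
- by rewrite coprimez_sym coprimezE prime_coprime // -dvdzE.
- by apply: (coprimez_comb (s := 0) (t := 1) (u := 1) (v := - 1) cxy); ring.
- by apply: (coprimez_comb (s := 1) (t := - 1) (u := 0) (v := 1) cxy); ring.
Qed.

(** Excludes norm 1 when the split prime l1 divides x + y. *)
Lemma norm1_bound (x y : int) : x ^+ 2 - x * y + y ^+ 2 = 1 -> ~ 3 <= `|x + y|.
Proof.
move=> E le3; have E4 : (x + y) ^+ 2 + 3 * (x - y) ^+ 2 = 4.
  by rewrite -[RHS]mulr1 -[X in _ = 4 * X]E; ring.
have : (x + y) ^+ 2 <= 4 by rewrite -E4 lerDl mulr_ge0 ?sqr_ge0.
by move: (x + y) le3; clear; nia.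
Qed.

Lemma norm_neqN1 (x y : int) : x ^+ 2 - x * y + y ^+ 2 = -1 -> False.
Proof.
move=> E; have := sqr_ge0 (x + y); have := sqr_ge0 (x - y).
have : (x + y) ^+ 2 + 3 * (x - y) ^+ 2 = 4 * -1 by rewrite -E; ring.
by move: ((x + y) ^+ 2) ((x - y) ^+ 2); clear; lia.
Qed.

Lemma dvd3_spec (x t e : int) : x = 3 * t + e -> (3 %| x)%Z = (3 %| e)%Z.
Proof. by move=> ->; rewrite rpredDl ?dvdz_mulr. Qed.

Lemma prime_pow_dvd_form (l i : nat) (v : int) : (0 < i)%N -> (l %| l%:Z ^+ i * v)%Z.
Proof. by case: i => // i _; rewrite exprS -mulrA dvdz_mulr. Qed.

(** No inert prime divides the norm. If 3 does not divide z, one of x, y is divisible by 3, and x +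
    y becomes the form of [ninth_root_form], so l1 would divide both x and y. *)
Lemma cube_sum_inert_inert (l1 l2 i j : nat) (s : int) (P := l1%:Z ^+ i) (Q := l2%:Z ^+ j) :
  prime l1 -> prime l2 -> l1 != l2 ->
  (l1 %% 9 = 2 \/ l1 %% 9 = 5)%N -> (l2 %% 9 = 2 \/ l2 %% 9 = 5)%N -> (0 < i)%N ->
  s = 1 \/ s = - 1 -> (9 %| P * Q - s)%Z -> ~ twisted_fermat P Q ->
  forall x y z, coprimez x y -> x ^+ 3 + y ^+ 3 = P * Q * z ^+ 3 -> z = 0.
Proof.
move=> p1 p2 l12 l1m l2m i0 s1 PQ9 hT.
have l1k : l1 = (3 * (l1 %/ 3) + 2)%N by lia.
have l2k : l2 = (3 * (l2 %/ 3) + 2)%N by lia.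
apply: (cube_sum_descent p1 p2 l12 l2k) => // [a b u v cab a3 _ E|x y z cxy E z3].
  by have := inert_ndvd_norm p1 l1k cab; rewrite E prime_pow_dvd_form.
have key (x' y' : int) : coprimez x' y' -> x' ^+ 3 + y' ^+ 3 = P * Q * z ^+ 3 ->
    (3 %| y')%Z -> False.
  move=> {}cxy {}E y3.
  have x3 : ~~ (3 %| x')%Z by apply/negP => x3; apply: (@coprimez_prime 3 _ _ isT cxy).
  have xy3 : ~~ (3 %| x' + y')%Z by rewrite rpredDr.
  have [|u [v [_ [[EA EB]|[_ EB]]]]] :=
    split_prime_powers (i := i) (j := j) (z := z) p1 p2 l12 (coprimez_add_norm cxy xy3) _
      (inert_ndvd_norm p2 l2k cxy).
  - by rewrite -E; ring.
  - have [r [t [Ex Ey]]] := primary_norm_cube cxy x3 y3 EB.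
    have [|r1 t1] := ninth_root_form (r := r) (s := t) p1 l1m.
      rewrite (_ : _ - _ = x' + y'); last by rewrite Ex Ey; ring.
      by rewrite EA -!mulrA prime_pow_dvd_form.
    apply: (coprimez_prime p1 cxy).
      by rewrite Ex rpredB ?rpredD ?dvdz_exp // mulrAC dvdz_mull.
    by rewrite Ey -!mulrA dvdz_mull // dvdz_mulr.
  - by have := inert_ndvd_norm p1 l1k cxy; rewrite EB prime_pow_dvd_form.
have [k1 [t1 [e1 [Ex Ext He1]]]] := @mul_cube_mod9 1 1 x isT.
have [k2 [t2 [e2 [Ey Eyt He2]]]] := @mul_cube_mod9 1 1 y isT.
have [k3 [t3 [e3 [Ez Ezt He3]]]] := mul_cube_mod9 z PQ9.
rewrite (dvd3_spec Ezt) in z3.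
(* Modulo 9 the cubes of x and y sum to 1 or -1, so one of them is 0. *)
have [e0|e0] : e1 = 0 \/ e2 = 0.
  have := E; rewrite Ez -[x ^+ 3]mul1r -[y ^+ 3]mul1r Ex Ey.
  case: He3 z3 => -> // _; case: s1 => ->; case: He1 => ->; case: He2 => ->; lia.
- case: (key y x); rewrite 1?coprimez_sym // 1?addrC //.
  by rewrite (dvd3_spec Ext) e0.
- by case: (key x y) => //; rewrite (dvd3_spec Eyt) e0.
Qed.

(** Each obstruction would make Q times a cube a nonzero cube modulo l1, and so l2 a cube. What is
    left descends to a smaller solution. *)
Lemma cube_sum_split_inert (l1 l2 i j m : nat) (al : int) (P := l1%:Z ^+ i) (Q := l2%:Z ^+ j) :
  prime l1 -> prime l2 -> l1 = (3 * m).+1 -> (l2 %% 3 = 2)%N -> (0 < i)%N -> (0 < j < 3)%N ->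
  ~ is_cube_mod l1 l2 -> (9 %| P * Q - al)%Z -> [\/ al = 2, al = 4, al = 5 | al = 7] ->
  forall x y z, coprimez x y -> x ^+ 3 + y ^+ 3 = P * Q * z ^+ 3 -> z = 0.
Proof.
move=> p1 p2 l1m l2m i0 j3 ncube PQ9 al4.
have l2k : l2 = (3 * (l2 %/ 3) + 2)%N by lia.
have l12 : l1 != l2 by lia.
have nl2 : ~~ (l1 %| l2)%N by rewrite dvdn_prime2.
have QE : Q%:~R = l2%:R ^+ j :> 'F_l1 by rewrite /Q rmorphXn.
have ncF (c u : 'F_l1) : c ^+ 3 = Q%:~R * u ^+ 3 -> c != 0 -> False.
  move=> Ec c0; apply: ncube.
  have u0 : u ^+ 3 != 0.
    apply: contra_neq c0 => u0.
    by move/eqP: Ec; rewrite u0 mulr0 expf_eq0 => /eqP.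
  apply: (@is_cube_mod_Fp l1 l2 j (c / u)) => //.
  by rewrite exprMn exprVn Ec QE mulfK.
have hT : ~ twisted_fermat P Q.
  move=> [X [Y [Z [E c]]]].
  have PX : (l1 %| P * X ^+ 3)%Z by rewrite prime_pow_dvd_form.
  have QY : ~~ (l1 %| Q * Y ^+ 3)%Z by apply/negP; apply: (coprimez_prime p1 c).
  rewrite !(dvdz_pcharf (pchar_Fp p1)) in PX QY.
  have EZ : (- Z%:~R) ^+ 3 = Q%:~R * Y%:~R ^+ 3 :> 'F_l1.
    transitivity ((Q * Y ^+ 3)%:~R - (P * X ^+ 3 + Q * Y ^+ 3 + Z ^+ 3)%:~R
      + (P * X ^+ 3)%:~R : 'F_l1); first by ring.
    by rewrite E (eqP PX); ring.
  apply: (ncF _ _ EZ); apply: contraNneq QY => Z0.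
  by rewrite rmorphM rmorphXn /= -EZ Z0 expr0n.
apply: (cube_sum_descent p1 p2 l12 l2k) => // [a b u v cab a3 Eb E|x y z cxy E z3].
  have b3 : (3 %| 3 * b)%Z by rewrite dvdz_mulr.
  have [|w [d [Ew E1 E2 d0]]] := primary_conj_cube (i := i.-1) (v := v) p1 l1m cab a3 b3.
    by rewrite E prednK.
  pose t := w - w ^+ 2.
  have t2 : t ^+ 2 = - 3 by exact: cube_root1_sub.
  (* As t^2 = -3, this says b t^3 = d^3, while b = Q u^3. *)
  have tb : - (3 * b%:~R * t) = d ^+ 3.
    by rewrite -E2 -[RHS]subr0 -[X in _ = _ - X]E1 /t; ring.
  have t0 : t != 0.
    apply: contra_neq d0 => t0.
    by move/eqP: tb; rewrite t0 mulr0 oppr0 eq_sym expf_eq0 => /eqP.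
  apply: (ncF (d / t) u%:~R); last by rewrite mulf_neq0 ?invr_eq0.
  transitivity (b%:~R : 'F_l1); last by rewrite Eb; ring.
  apply: (mulIf (expf_neq0 3 t0)); rewrite -exprMn divfK //.
  by rewrite -tb [t ^+ 3]exprS t2; ring.
have [k1 [t1 [e1 [Ex Ext He1]]]] := @mul_cube_mod9 1 1 x isT.
have [k2 [t2 [e2 [Ey Eyt He2]]]] := @mul_cube_mod9 1 1 y isT.
have [k3 [t3 [e3 [Ez Ezt He3]]]] := mul_cube_mod9 z PQ9.
rewrite (dvd3_spec Ezt) in z3.
(* Modulo 9, e1 + e2 is one of 2, -2, 4, -4. *)
have [e12 e0] : e1 = e2 /\ (e1 = 1 \/ e1 = -1).
  have := E; rewrite Ez -[x ^+ 3]mul1r -[y ^+ 3]mul1r Ex Ey.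
  by case: He3 z3 => -> // _; move: al4 He1 He2; clear;
    do 3!case=> ->; move=> Ek; (split; first lia); try lia.
have xy3 : ~~ (3 %| x + y)%Z.
  rewrite (@dvd3_spec _ (t1 + t2) (e1 + e2)); last by rewrite Ext Eyt; ring.
  by rewrite -e12; case: e0 => ->.
have y3 : ~~ (3 %| y)%Z by rewrite (dvd3_spec Eyt) -e12; case: e0 => ->.
(* Hence y + (y - x) omega = - omega (x + y omega) is the primary associate of x + y omega. *)
have yx3 : (3 %| y - x)%Z.
  by rewrite (@dvd3_spec _ (t2 - t1) 0) // Ext Eyt e12; ring.
have cyx : coprimez y (y - x).
  by apply: (coprimez_comb (s := 1) (t := - 1) (u := 1) (v := 0) cxy); ring.
have EN : y ^+ 2 - y * (y - x) + (y - x) ^+ 2 = x ^+ 2 - x * y + y ^+ 2 by ring.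
have [|u [v [Euv [[EA EB]|[EA EB]]]]] :=
  split_prime_powers (i := i) (j := j) (z := z) p1 p2 l12 (coprimez_add_norm cxy xy3) _
    (inert_ndvd_norm p2 l2k cxy).
- by rewrite -E; ring.
- have [r [s [Er Es]]] := primary_norm_cube cyx y3 yx3 (etrans EN EB).
  have crs : coprimez r s.
    apply: (coprimez_comb (s := r ^+ 2) (t := s ^+ 2 - 3 * r * s)
      (u := 3 * s * (r - s)) (v := 0) cyx).
      by rewrite Er; ring.
    by rewrite Es; ring.
  (* x + y is the trace of beta^3 for beta = r + s omega, a sum of two conjugate cubes. *)
  have Exy : x + y = (r + s) * (2 * r - s) * (r - 2 * s).
    by transitivity (2 * y - (y - x)); [|rewrite Es Er]; ring.
  have rs3 : ~~ (3 %| r + s)%Z.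
    by apply: contra xy3 => rs3; rewrite Exy -mulrA dvdz_mulr.
  have crs' : coprimez (r + s) (r - 2 * s).
    rewrite (_ : r - 2 * s = 1 * (r + s) + (- 3) * s); last by ring.
    apply: coprimez_addMl; rewrite coprimezMr; apply/andP; split.
      by rewrite coprimez_sym coprimezE prime_coprime // -dvdzE.
    by apply: (coprimez_comb (s := 1) (t := - 1) (u := 0) (v := 1) crs); ring.
  have u0 : u != 0.
    by apply: contraNneq xy3 => u0; rewrite EA u0 expr0n mulr0.
  have [|||[X [Y [Z [cXY EXY Z0 lt]]]]|//] :=
    triple_split (p := r + s) (q := r - 2 * s) (r := s - 2 * r) (u := - u)
      p1 p2 l12 _ crs' _ _ (i := i) (j := j).
  + by ring.
  + by transitivity (- (x + y)); [rewrite Exy | rewrite EA]; ring.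
  + by rewrite oppr_eq0.
  exists X, Y, Z; split=> //; apply: le_lt_trans lt _; rewrite normrN Euv.
  have z0 : z != 0 by apply: contraNneq z3 => z0; rewrite -(dvd3_spec Ezt) z0.
  have v0 : v != 0 by apply: contra_neq z0 => v0; rewrite Euv v0 mulr0.
  (* Since z = u v, strict descent requires |v| > 1. *)
  have v1 : v <> 1.
    move=> v1.
    have l1xy : (l1 %| x + y)%Z by rewrite EA -!mulrA prime_pow_dvd_form.
    have /(dvdn_leq _) : (l1 %| `|(x + y)%R|)%N by rewrite -[(_ %| _)%N]/(l1%:Z %| x + y)%Z.
    have xy0 : x + y != 0 by apply: contraNneq xy3 => ->.
    rewrite absz_gt0 xy0 => /(_ isT) l1le; apply: (norm1_bound (etrans EB _)); rewrite ?v1 //.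
    by move: l1le (prime_gt1 p1) l1m; clear; lia.
  have vN1 : v <> -1.
    by move=> vN1; apply: (norm_neqN1 (etrans EB _)); rewrite vN1.
  by move: u0 v0 v1 vN1; clear; nia.
- have [|w [d [Ew E1 E2 d0]]] := primary_conj_cube (i := i.-1) (v := v) p1 l1m cyx y3 yx3.
    by rewrite EN EB prednK.
  case: (ncF d u%:~R) => //.
  transitivity ((x + y)%:~R : 'F_l1); last by rewrite EA; ring.
  (* Adding the two residues gives the trace x + y, because w + w^2 = -1. *)
  rewrite -E2 -[LHS]addr0 -[X in _ + X = _]E1.
  transitivity ((x + y)%:~R + (y - x)%:~R * (w ^+ 2 + w + 1)); first by ring.
  by rewrite Ew mulr0 addr0.
Qed.

(** * From the curve to sums of two cubes *)

Lemma gcdz_quotients (a b : int) : gcdz a b != 0 ->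
  exists a' b', [/\ a = a' * gcdz a b, b = b' * gcdz a b & coprimez a' b'].
Proof.
move=> g0; have /dvdzP[a' Ea] := dvdz_gcdl a b; have /dvdzP[b' Eb] := dvdz_gcdr a b.
exists a', b'; split=> //; have [s [t Bez]] := Bezoutz a b.
apply/coprimezP; exists (s, t) => /=; apply: (mulIf g0).
by move: (gcdz a b) Ea Eb Bez => g -> -> Bez; rewrite mul1r -[RHS]Bez; ring.
Qed.

(** After removal of common factors with d, the cube of what is left of gcd(a, b) divides n, so it
    is 1 or -1. *)
Lemma primitive_cube_sum (n : nat) (a b d : int) : (0 < n)%N ->
  (forall q : nat, prime q -> ~~ (q ^ 3 %| n)%N) ->
  a ^+ 3 + b ^+ 3 = n%:Z * d ^+ 3 -> d != 0 ->
  exists x y z : int, [/\ coprimez x y, x ^+ 3 + y ^+ 3 = n%:Z * z ^+ 3 & z != 0].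
Proof.
move=> n0 cubefree E d0.
have g0 : gcdz a b != 0.
  rewrite gcdz_eq0; apply: contra_neqN d0 => /andP[/eqP a0 /eqP b0].
  move/eqP: E; rewrite a0 b0 expr0n addr0 eq_sym mulf_eq0 expf_eq0 /=.
  by case/orP => /eqP //; lia.
have [x [y [Ea Eb cxy]]] := gcdz_quotients g0.
move: (gcdz a b) g0 Ea Eb => g g0 Ea Eb.
have h0 : gcdz g d != 0 by rewrite gcdz_eq0 negb_and g0.
have [g' [d' [Eg Ed cgd]]] := gcdz_quotients h0.
have E' : g' ^+ 3 * (x ^+ 3 + y ^+ 3) = n%:Z * d' ^+ 3.
  apply: (mulIf (expf_neq0 3 h0)); move: E; rewrite Ea Eb [in RHS]Ed {1 2}Eg => E.
  by transitivity (n%:Z * (d' * gcdz g d) ^+ 3); [rewrite -E|]; ring.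
have gn : (g' ^+ 3 %| n%:Z)%Z.
  by rewrite -(@Gauss_dvdzl _ _ (d' ^+ 3)) ?coprimez_pexpl ?coprimez_pexpr // -E' dvdz_mulr.
have g1 : `|g'|%N = 1%N.
  have g'0 : (0 < `|g'|)%N by rewrite absz_gt0; apply: contra_neq g0 => g'0; rewrite Eg g'0 mul0r.
  apply/eqP; rewrite eqn_leq g'0 andbT leqNgt; apply/negP => /pdiv_prime pq.
  have := cubefree _ pq; apply/negP; rewrite negbK.
  apply: dvdn_trans (_ : `|g'| ^ 3 %| n)%N; first by rewrite dvdn_exp2r // pdiv_dvd.
  by rewrite -abszX.
have d'0 : d' != 0 by apply: contra_neq d0 => d'0; rewrite Ed d'0 mul0r.
have [g1'|g1'] : g' = 1 \/ g' = -1 by move: g1; clear; lia.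
  by exists x, y, d'; split=> //; rewrite -E' g1'; ring.
by exists x, y, (- d'); rewrite oppr_eq0; split=> //; rewrite exprNn mulrCA -E' g1'; ring.
Qed.

Lemma rat_cube_sum (n : nat) (X Y : rat) : X ^+ 3 + Y ^+ 3 = n%:R ->
  exists a b d : int, a ^+ 3 + b ^+ 3 = n%:Z * d ^+ 3 /\ d != 0.
Proof.
move=> E; exists (numq X * denq Y), (numq Y * denq X), (denq X * denq Y).
split; last by rewrite mulf_neq0 ?denq_neq0.
apply: (@intr_inj rat).
have EX : (numq X)%:~R = X * (denq X)%:~R :> rat by rewrite numqE.
have EY : (numq Y)%:~R = Y * (denq Y)%:~R :> rat by rewrite numqE.
transitivity ((X ^+ 3 + Y ^+ 3) * ((denq X)%:~R * (denq Y)%:~R) ^+ 3).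
  by rewrite !(rmorphD, rmorphXn, rmorphM) /= EX EY; ring.
by rewrite E; ring.
Qed.

Lemma curve_cube_sum (n : nat) (x y : rat) : (0 < n)%N -> on_Em (m_of_n n) (Some (x, y)) ->
  exists X Y : rat, X ^+ 3 + Y ^+ 3 = n%:R.
Proof.
rewrite /m_of_n /= natrM natrX => n0 E.
have N0 : (n%:R : rat) != 0 by rewrite pnatr_eq0 -lt0n.
have x0 : x != 0.
  apply: contraTneq (sqr_ge0 y) => x0; rewrite E x0 expr0n add0r -ltNge oppr_lt0.
  by rewrite mulr_gt0 // exprn_gt0 // ltr0n.
(* The numerator 2 (36 n)^3 + 216 n y^2 of the sum of cubes equals n (6 x)^3 on the curve. *)
exists ((36 * n%:R + y) / (6 * x)), ((36 * n%:R - y) / (6 * x)).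
rewrite !expr_div_n -mulrDl; apply: (mulIf (expf_neq0 3 (mulf_neq0 (_ : 6 != 0 :> rat) x0))) => //.
rewrite divfK ?expf_neq0 ?mulf_neq0 //.
transitivity (2 * (36 * n%:R) ^+ 3 + 6 * (36 * n%:R) * y ^+ 2); first by ring.
by rewrite E; ring.
Qed.

(** For these pairs, the residues of P and Q in the inert cases, the congruence modulo 9 forces 3 to
    divide both X and Y. *)
Lemma twisted_fermat_mod9 (P Q al be : int) : (9 %| P - al)%Z -> (9 %| Q - be)%Z ->
  (al, be) \in [:: (2, 5); (4, 7); (4, 2); (7, 5)] -> ~ twisted_fermat P Q.
Proof.
move=> P9 Q9 albe [X [Y [Z [E c]]]].
have [k1 [t1 [e1 [E1 X3 He1]]]] := mul_cube_mod9 X P9.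
have [k2 [t2 [e2 [E2 Y3 He2]]]] := mul_cube_mod9 Y Q9.
have [k3 [t3 [e3 [E3 _ He3]]]] := @mul_cube_mod9 1 1 Z isT.
have [e10 e20] : e1 = 0 /\ e2 = 0.
  move: E; rewrite -[Z ^+ 3]mul1r E1 E2 E3; move: albe He1 He2 He3; clear.
  by rewrite !inE => /or4P[]/eqP[-> ->]; do 3!case=> ->; move=> E; split; lia.
apply: (@coprimez_prime 3 _ _ isT c); rewrite dvdz_mull // dvdz_exp //.
  by rewrite (dvd3_spec X3) e10.
by rewrite (dvd3_spec Y3) e20.
Qed.

Lemma PoszXn (l i : nat) : (l ^ i)%N%:Z = l%:Z ^+ i.
Proof. by elim: i => // i IHi; rewrite expnS PoszM IHi exprS. Qed.

(** An affine point would give a primitive solution, so only the point at infinity remains. *)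
Lemma rank_zero_no_cube_sum (n : nat) : (0 < n)%N ->
  (forall q : nat, prime q -> ~~ (q ^ 3 %| n)%N) ->
  (forall x y z : int, coprimez x y -> x ^+ 3 + y ^+ 3 = n%:Z * z ^+ 3 -> z = 0) ->
  rank_zero (m_of_n n).
Proof.
move=> n0 cubefree noSol [[x y]|_]; last by exists 1%N.
case/(curve_cube_sum n0) => X [Y /rat_cube_sum[a [b [d [E d0]]]]].
have [x' [y' [z [cxy Ez z0]]]] := primitive_cube_sum n0 cubefree E d0.
by rewrite (noSol _ _ _ cxy Ez) eqxx in z0.
Qed.

(** * Residues modulo 9 and the four cases *)

Lemma dvdz_expr_mod (m l r i : nat) : (l %% m = r)%N ->
  (m %| l%:Z ^+ i - ((r ^ i) %% m)%N%:Z)%Z.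
Proof.
by move=> <-; rewrite -eqz_mod_dvd -PoszXn !modz_nat modnXm modn_mod.
Qed.

Lemma dvdz_sub_mul (m P Q al be s : int) : (m %| P - al)%Z -> (m %| Q - be)%Z ->
  (m %| al * be - s)%Z -> (m %| P * Q - s)%Z.
Proof.
move=> mP mQ ms; rewrite (_ : _ - s = P * (Q - be) + (P - al) * be + (al * be - s)); last by ring.
by apply: rpredD => //; apply: rpredD; [exact: dvdz_mull | exact: dvdz_mulr].
Qed.

Lemma no_cube_sum_inert (n l1 l2 i j r1 r2 : nat) (s : int) :
  prime l1 -> prime l2 -> l1 != l2 -> n = (l1 ^ i * l2 ^ j)%N -> (0 < i)%N ->
  (l1 %% 9 = r1)%N -> (l2 %% 9 = r2)%N -> r1 = 2%N \/ r1 = 5%N -> r2 = 2%N \/ r2 = 5%N ->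
  s = 1 \/ s = - 1 -> (9 %| ((r1 ^ i) %% 9)%N%:Z * ((r2 ^ j) %% 9)%N%:Z - s)%Z ->
  (((r1 ^ i) %% 9)%N%:Z, ((r2 ^ j) %% 9)%N%:Z) \in [:: (2, 5); (4, 7); (4, 2); (7, 5)] ->
  forall x y z : int, coprimez x y -> x ^+ 3 + y ^+ 3 = n%:Z * z ^+ 3 -> z = 0.
Proof.
move=> p1 p2 l12 -> i0 m1 m2 r12 r25 s1 s9 albe; rewrite PoszM !PoszXn.
have P9 := dvdz_expr_mod i m1; have Q9 := dvdz_expr_mod j m2.
apply: (cube_sum_inert_inert (s := s)) => //; rewrite ?m1 ?m2 //.
  exact: dvdz_sub_mul P9 Q9 s9.
exact: twisted_fermat_mod9 P9 Q9 albe.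
Qed.

Lemma no_cube_sum_split (n l1 l2 i j r : nat) : prime l1 -> prime l2 ->
  n = (l1 ^ i * l2 ^ j)%N -> (0 < i)%N -> (0 < j < 3)%N ->
  (l1 %% 3 = 1)%N -> (l2 %% 3 = 2)%N -> ~ is_cube_mod l1 l2 ->
  (n %% 9 = r)%N -> r \in [:: 2; 4; 5; 7]%N ->
  forall x y z : int, coprimez x y -> x ^+ 3 + y ^+ 3 = n%:Z * z ^+ 3 -> z = 0.
Proof.
move=> p1 p2 nE i0 j3 m1 m2 nc n9 r4.
have PQ9 : (9 %| n%:Z - r%:Z)%Z by move: n9; clear; lia.
rewrite nE PoszM !PoszXn in PQ9 *.
apply: (cube_sum_split_inert (m := (l1 %/ 3)%N) (al := r)) => //; first by lia.
by move: r4; rewrite !inE => /or4P[]/eqP->;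
  [constructor 1 | constructor 2 | constructor 3 | constructor 4].
Qed.

End NoCubeSum.

Theorem theorem3p1 (n l1 l2 : nat) :
  (0 < n)%N ->
  (forall p : nat, prime p -> ~~ (p ^ 3 %| n)) ->
  coprime n 3 ->
  prime l1 -> prime l2 -> l1 != l2 ->
  l1 %| n -> l2 %| n ->
  (forall p : nat, prime p -> p %| n -> p = l1 \/ p = l2) ->
  ( (* (1) *)
    ((n = l1 * l2 \/ n = l1 ^ 2 * l2 ^ 2) /\ l1 %% 9 = 2 /\ l2 %% 9 = 5)
  \/ (* (2) *)
    (n = l1 ^ 2 * l2 /\
     ((l1 %% 9 = 2 /\ l2 %% 9 = 2) \/ (l1 %% 9 = 5 /\ l2 %% 9 = 5)))
  \/ (* (3) *)
    ((n = l1 * l2 \/ n = l1 ^ 2 * l2) /\ (n %% 9 = 2 \/ n %% 9 = 5) /\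
     l1 %% 3 = 1 /\ l2 %% 3 = 2 /\ ~ is_cube_mod l1 l2)
  \/ (* (4) *)
    ((n = l1 ^ 2 * l2 ^ 2 \/ n = l1 * l2 ^ 2) /\ (n %% 9 = 4 \/ n %% 9 = 7) /\
     l1 %% 3 = 1 /\ l2 %% 3 = 2 /\ ~ is_cube_mod l1 l2) )%N ->
  rank_zero (m_of_n n).
Proof.
move=> n0 cubefree _ p1 p2 l12 _ _ _ Hcases.
apply: rank_zero_no_cube_sum => //.
have inert i j r1 r2 s := @no_cube_sum_inert n l1 l2 i j r1 r2 s p1 p2 l12.
have split i j r := @no_cube_sum_split n l1 l2 i j r p1 p2.
case: Hcases => [[nE [m1 m2]]|[[nE m12]|[[nE [n9 [m1 [m2 nc]]]]|[nE [n9 [m1 [m2 nc]]]]]]].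
(* The sign is n modulo 9: 2 * 5 and 4 * 7 are 1, while 4 * 2 and 7 * 5 in the next case are -1. *)
- case: nE => nE.
    by apply: (inert 1 1 2 5 1%R) => //; by [left | right].
  by apply: (inert 2 2 2 5 1%R) => //; by [left | right].
- case: m12 => -[m1 m2].
    by apply: (inert 2 1 2 2 (- 1)%R) => //; by [left | right].
  by apply: (inert 2 1 5 5 (- 1)%R) => //; by [left | right].
- by case: nE n9 => nE [] n9; [exact: (split 1 1 2) | exact: (split 1 1 5)
    | exact: (split 2 1 2) | exact: (split 2 1 5)].
- by case: nE n9 => nE [] n9; [exact: (split 2 2 4) | exact: (split 2 2 7)
    | exact: (split 1 2 4) | exact: (split 1 2 7)].
Qed.
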